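(* Let $N,n\in\mathbb{Z}_{\ge 1}$, let $\underline t=(t_3,t_5,\ldots,t_{2N-1})\in\mathbb{C}^{N-1}$, and put $t_{2N+1}:=-\frac{1}{2N+1}$. Let $\delta_n=(n,n-1,\ldots,2,1)$ be the staircase partition of length $n$. Then the generalized Vorob'ev-Yablonski polynomial $\mathcal{Q}_n^{[N]}(x;\underline t)$ satisfies, for all $x\in\mathbb{C}$, $$\mathcal{Q}_n^{[N]}(x;\underline t)=\prod_{k=1}^n\frac{(2k)!}{2^k k!}\; s_{\delta_n}\big(x,0,2^2t_3,0,2^4t_5,\ldots,2^{2N}t_{2N+1},0,0,0,\ldots\big),$$ where the argument of $s_{\delta_n}$ has $x$ in position $1$, $2^{2j}t_{2j+1}$ in position $2j+1$ for $1\le j\le N$, and $0$ in all other positions.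
   Context: Lenard operators: the differential polynomials $\mathcal{L}_k[u]$ are defined by $\frac{d}{dx}\mathcal{L}_{k+1}[u]=\left(\frac{d^3}{dx^3}+4u\frac{d}{dx}+2u_x\right)\mathcal{L}_k[u]$ for $k\ge 0$, $\mathcal{L}_0[u]=\frac12$, with the integration constants fixed by $\mathcal{L}_k[0]=0$ for $k\ge1$ (so $\mathcal{L}_1[u]=u$, $\mathcal{L}_2[u]=u_{xx}+3u^2$). Generalized Vorob'ev-Yablonski polynomials: $\mathcal{Q}_n^{[N]}(x;\underline t)$ is defined by $\mathcal{Q}_0^{[N]}=1$, $\mathcal{Q}_1^{[N]}=x$ and, for $n\ge1$, $$\mathcal{Q}_{n+1}^{[N]}\mathcal{Q}_{n-1}^{[N]}=\big(\mathcal{Q}_n^{[N]}\big)^2\Big\{x-2\mathcal{L}_N\Big[2\tfrac{d^2}{dx^2}\ln\mathcal{Q}_n^{[N]}\Big]+2\sum_{k=1}^{N-1}(2k+1)t_{2k+1}\mathcal{L}_k\Big[2\tfrac{d^2}{dx^2}\ln\mathcal{Q}_n^{[N]}\Big]\Big\}.$$ Schur polynomials: for $\mathbf t=(t_1,t_2,t_3,\ldots)$ define $h_k(\mathbf t)$ by $\sum_{k\ge0}h_k(\mathbf t)z^k=\exp\big(\sum_{j\ge1}t_jz^j\big)$ and $h_k=0$ for $k<0$; for a partition $\lambda=(\lambda_1\ge\cdots\ge\lambda_{\ell(\lambda)}>0)$ put $s_\lambda(\mathbf t)=\det[h_{\lambda_j-j+k}(\mathbf t)]_{j,k=1}^{\ell(\lambda)}$.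 *)

(* Defs.v *)
From mathcomp Require Import all_boot all_order all_algebra.
From mathcomp Require Import finmap.
From mathcomp.multinomials Require Import monalg.
From mathcomp Require Import ring.
From mathcomp Require Import boolp.

Set Implicit Arguments.
Unset Strict Implicit.
Unset Printing Implicit Defensive.

Import GRing.Theory Num.Theory.
Local Open Scope ring_scope.

Notation "p %:F" := (@FracField.tofrac _ p) : ring_scope.

(* Quotient rule on the representative n/d picked by repr; see ratderivE. *)
Definition ratderiv (F : fieldType) (f : {fraction {poly F}}) :
    {fraction {poly F}} :=
  let n := \n_(repr f) in
  let d := \d_(repr f) in
  (n^`() * d - n * d^`())%:F / (d ^+ 2)%:F.

Lemma fraction_numden (R : idomainType) (f : {fraction R}) :
  f = (\n_(repr f))%:F / (\d_(repr f))%:F.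
Proof.
rewrite -[LHS]reprK !generic_quotient.piE.
rewrite /FracField.mulf /FracField.invf !numden_Ratio ?oner_neq0 ?denom_ratioP //.
by rewrite mulr1 mul1r Ratio_numden.
Qed.

Lemma ratderivE (F : fieldType) (p q : {poly F}) : q != 0 ->
  ratderiv (p%:F / q%:F) = (p^`() * q - p * q^`())%:F / (q ^+ 2)%:F.
Proof.
move=> q0; set f := p%:F / q%:F; rewrite /ratderiv.
have := fraction_numden f; have d0 := denom_ratioP (repr f).
move: (\n_(repr f)) (\d_(repr f)) d0 => n d d0 /eqP.
rewrite eqr_div ?tofrac_eq0 // -!tofracM tofrac_eq => /eqP pdE.
have := congr1 (@deriv F) pdE; rewrite !derivM => dE.
apply/eqP; rewrite eqr_div ?tofrac_eq0 ?expf_neq0 // -!tofracM tofrac_eq.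
apply/eqP.
have -> : (n^`() * d - n * d^`()) * q ^+ 2 =
  d * q * (n^`() * q + n * q^`()) - n * q * (d * q^`() + d^`() * q) by ring.
by rewrite -dE -pdE; ring.
Qed.

(* The second derivative of ln f, i.e. the derivative of f'/f. *)
Definition d2ln (F : fieldType) (f : {fraction {poly F}}) :
    {fraction {poly F}} :=
  ratderiv (ratderiv f / f).

(* The indeterminate of index i stands for the i-th derivative of u. *)
Notation diffpoly F := {malg F[{cmonom nat}]}.

Definition uvar (F : fieldType) (i : nat) : diffpoly F := << ucm i >>.

Definition monderiv (F : fieldType) (m : {cmonom nat}) : diffpoly F :=
  \sum_(i <- finsupp m) (m i)%:R * << divcm m (ucm i) >> * uvar F i.+1.

(* The F-linear extension of monderiv: the derivation with D u^(i) = u^(i+1). *)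
Definition dpderiv (F : fieldType) (P : diffpoly F) : diffpoly F :=
  mmap (@malgC {cmonom nat} F) (@monderiv F) P.

(* P[w]: u^(i) is replaced by the i-th derivative of w. *)
Definition dpsubst (F : fieldType) (P : diffpoly F) (w : {fraction {poly F}}) :
    {fraction {poly F}} :=
  mmap (@FracField.tofrac {poly F} \o polyC)
    (fun m : {cmonom nat} =>
       \prod_(i <- finsupp m) iter i (@ratderiv F) w ^+ m i)
    P.

Definition is_lenard (F : fieldType) (L : nat -> diffpoly F) : Prop :=
  [/\ L 0%N = (2^-1)%:MP,
      forall k, dpderiv (L k.+1) =
        dpderiv (dpderiv (dpderiv (L k))) +
        4 * uvar F 0 * dpderiv (L k) + 2 * uvar F 1 * L k
    & forall k, (0 < k)%N -> dpsubst (L k) 0 = 0].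

Lemma malgZU (R : comNzRingType) (K : monomType) (c a : R) (k : K) :
  c *: << a *g k >> = << c * a *g k >> :> {malg R[K]}.
Proof. by apply/malgP => k'; rewrite mcoeffZ !mcoeffU mulrnAr. Qed.

Lemma malgUM (R : comNzRingType) (K : monomType) (c1 c2 : R) (k1 k2 : K) :
  << c1 *g k1 >> * << c2 *g k2 >> = << c1 * c2 *g mmul k1 k2 >> :> {malg R[K]}.
Proof. by rewrite malgM_def fgmulUU. Qed.

Lemma malgU1M (R : comNzRingType) (K : monomType) (k1 k2 : K) :
  << mmul k1 k2 >> = << k1 >> * << k2 >> :> {malg R[K]}.
Proof. by rewrite malgUM mulr1. Qed.

Lemma malgU1Z (R : comNzRingType) (K : monomType) (c : R) (k : K) :
  << c *g k >> = c *: << k >> :> {malg R[K]}.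
Proof. by rewrite malgZU mulr1. Qed.

Lemma malg_ind (R : comNzRingType) (K : monomType) (p : {malg R[K]} -> Prop) :
  (forall c k, p << c *g k >>) -> (forall P Q, p P -> p Q -> p (P + Q)) ->
  forall P, p P.
Proof.
move=> pU pD P; rewrite (monalgE P); apply: (big_ind p); [|exact: pD|by move=> k _; exact: pU].
by rewrite -(@monalgU0 K R mone); exact: pU.
Qed.

Lemma mcoeff1M (R : comNzRingType) (K : monomType) (P Q : {malg R[K]}) :
  mcoeff mone (P * Q) = mcoeff mone P * mcoeff mone Q.
Proof. exact: rmorphM. Qed.

Section LinearExtension.
Variables (R : comNzRingType) (K : monomType) (h : K -> {malg R[K]}).
Implicit Types P Q : {malg R[K]}.
Local Notation ext := (mmap (@malgC K R) h).

Lemma linextU c k : ext << c *g k >> = c *: h k.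
Proof. by rewrite mmapU mul_malgC. Qed.

Lemma linextD P Q : ext (P + Q) = ext P + ext Q.
Proof. exact: raddfD. Qed.

Lemma linextZ c P : ext (c *: P) = c *: ext P.
Proof.
elim/malg_ind: P => [a m|P Q IHP IHQ].
  by rewrite linextU scalerA -linextU malgZU.
by rewrite scalerDr !linextD IHP IHQ scalerDr.
Qed.
End LinearExtension.

Lemma linextM (R : comNzRingType) (K : conomType) (h : K -> {malg R[K]})
    (P Q : {malg R[K]}) :
  (forall k1 k2, h (mmul k1 k2) = h k1 * << k2 >> + << k1 >> * h k2) ->
  mmap (@malgC K R) h (P * Q) =
  mmap (@malgC K R) h P * Q + P * mmap (@malgC K R) h Q.
Proof.
move=> hM.
have scalerE (A : comAlgType R) (a b : R) (x y z w : A) :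
    (a * b) *: (x * y + z * w) = (a *: x) * (b *: y) + (a *: z) * (b *: w).
  by rewrite -!scalerAl -!scalerAr !scalerA scalerDr.
elim/malg_ind: P => [a1 m1|P1 P2 IH1 IH2]; last first.
  by rewrite mulrDl !linextD IH1 IH2 !mulrDl addrACA.
elim/malg_ind: Q => [a2 m2|Q1 Q2 IH1 IH2]; last first.
  by rewrite mulrDr !linextD IH1 IH2 !mulrDr addrACA.
rewrite malgUM !linextU hM (malgU1Z a1) (malgU1Z a2).
exact: scalerE.
Qed.

Section DerivTheory.
Variable F : fieldType.
Implicit Types (P Q : diffpoly F) (m : {cmonom nat}).

Lemma monderivEw m (d : {fset nat}) : (finsupp m `<=` d)%fset ->
  monderiv F m =
  \sum_(i <- d) (m i)%:R * << divcm m (ucm i) >> * uvar F i.+1.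
Proof.
move=> le; apply: big_fset_incl => // i _.
by rewrite -cmE_eq0 => /eqP ->; rewrite !mul0r.
Qed.

Lemma divcm_mull m1 m2 i : m1 i != 0%N ->
  divcm (mmul m1 m2) (ucm i) = mmul (divcm m1 (ucm i)) m2.
Proof.
move=> m1i; apply/eqP/cmP => j.
rewrite !(cmM, divcmE) cmU; have [<-|_] := eqVneq i j; last by rewrite !subn0.
by rewrite addnBAC // lt0n.
Qed.

Lemma monderivM_term m1 m2 i :
  (m1 i)%:R * << divcm (mmul m1 m2) (ucm i) >> =
  (m1 i)%:R * (<< divcm m1 (ucm i) >> * << m2 >>) :> diffpoly F.
Proof.
have [->|m1i] := eqVneq (m1 i) 0%N; first by rewrite mulr0n !mul0r.
by rewrite (divcm_mull _ m1i) (malgU1M F (divcm m1 (ucm i)) m2).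
Qed.

Lemma monderivM m1 m2 :
  monderiv F (mmul m1 m2) =
  monderiv F m1 * << m2 >> + << m1 >> * monderiv F m2.
Proof.
have le1 : (finsupp m1 `<=` finsupp (mmul m1 m2))%fset.
  by rewrite mdomD; exact: fsubsetUl.
have le2 : (finsupp m2 `<=` finsupp (mmul m1 m2))%fset.
  by rewrite mdomD; exact: fsubsetUr.
rewrite (monderivEw le1) (monderivEw le2) (monderivEw (fsubset_refl _)).
rewrite mulr_suml mulr_sumr -big_split /=; apply: eq_bigr => i _.
have ringE (T : comNzRingType) (a b k x y z w u : T) :
    a * k = a * (x * y) -> b * k = b * (z * w) ->
    (a + b) * k * u = a * x * u * y + w * (b * z * u).
  move=> E1 E2; rewrite mulrDl E1 E2 mulrDl !mulrA; congr (_ + _).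
    by rewrite -!mulrA [y * u]mulrC.
  by rewrite -!mulrA (mulrCA w b) (mulrCA w z).
rewrite cmM natrD; apply: ringE; first exact: monderivM_term.
by rewrite mulmC; exact: monderivM_term.
Qed.

Lemma dpderivU c m : dpderiv << c *g m >> = c *: monderiv F m.
Proof. exact: linextU. Qed.

Lemma dpderivD P Q : dpderiv (P + Q) = dpderiv P + dpderiv Q.
Proof. exact: linextD. Qed.

Lemma dpderivZ c P : dpderiv (c *: P) = c *: dpderiv P.
Proof. exact: linextZ. Qed.

Lemma dpderivM P Q : dpderiv (P * Q) = dpderiv P * Q + P * dpderiv Q.
Proof. exact/linextM/monderivM. Qed.

Lemma dpderivC c : dpderiv c%:MP = 0 :> diffpoly F.
Proof. by rewrite dpderivU /monderiv mdom1 big_seq_fset0 scaler0. Qed.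

Lemma dpderivX i : dpderiv (uvar F i) = uvar F i.+1.
Proof.
rewrite /uvar dpderivU scale1r /monderiv mdomU big_seq_fset1 cmUU mul1r.
suff -> : divcm (ucm i) (ucm i) = mone by rewrite mul1r.
by apply/eqP/cmP => j; rewrite divcmE cm1 subnn.
Qed.

End DerivTheory.

(* Existence of the Lenard sequence: in a commutative differential ring with
   1/2, the coefficients of the first integral 2 f f'' - f'^2 + 4 u f^2 of
   f''' + 4 u f' + 2 u' f give a recursion without integration. *)
Section LenardExistence.
Variables (A : comNzRingType) (D : A -> A) (u h : A).
Hypothesis DD : {morph D : x y / x + y}.
Hypothesis DM : forall x y, D (x * y) = D x * y + x * D y.
Hypothesis h2 : 2 * h = 1.

Definition lenard_next (s : seq A) : A :=
  let m := (size s).-1 in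
  \sum_(i < m.+1) (2 * s`_i * D (D s`_(m - i)) - D s`_i * D s`_(m - i)
                   + 4 * u * s`_i * s`_(m - i))
  - \sum_(i < m) s`_i.+1 * s`_(m - i).

Definition lenard_list (k : nat) : seq A :=
  iter k (fun s => rcons s (lenard_next s)) [:: h].

Definition lenard_seq (k : nat) : A := (lenard_list k)`_k.

Lemma size_lenard_list k : size (lenard_list k) = k.+1.
Proof. by elim: k => //= k IHk; rewrite size_rcons IHk. Qed.

Lemma nth_lenard_list k i : (i <= k)%N -> (lenard_list k)`_i = lenard_seq i.
Proof.
elim: k => [|k IHk]; first by rewrite leqn0 => /eqP ->.
rewrite leq_eqVlt => /predU1P[-> //|lt_ik].
by rewrite /= nth_rcons size_lenard_list lt_ik IHk.
Qed.

Lemma lenard_seqS m : lenard_seq m.+1 =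
  \sum_(i < m.+1)
     (2 * lenard_seq i * D (D (lenard_seq (m - i)))
      - D (lenard_seq i) * D (lenard_seq (m - i))
      + 4 * u * lenard_seq i * lenard_seq (m - i))
  - \sum_(i < m) lenard_seq i.+1 * lenard_seq (m - i).
Proof.
rewrite {1}/lenard_seq /= nth_rcons size_lenard_list ltnn eqxx /lenard_next.
rewrite size_lenard_list /=; congr (_ - _); apply: eq_bigr => i _.
  by rewrite !nth_lenard_list ?leq_subr // -ltnS.
by rewrite !nth_lenard_list ?leq_subr.
Qed.

Lemma lenard_D0 : D 0 = 0.
Proof. by apply: (addrI (D 0)); rewrite -DD !addr0. Qed.

Lemma lenard_DN x : D (- x) = - D x.
Proof. by apply: (addrI (D x)); rewrite -DD !subrr lenard_D0. Qed.

Lemma lenard_D1 : D 1 = 0.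
Proof. by apply: (addrI (D 1)); rewrite -{3}[1]mulr1 DM mulr1 mul1r addr0. Qed.

Lemma lenard_Dnat n : D n%:R = 0.
Proof. by elim: n => [|n IHn]; rewrite ?lenard_D0 // -natr1 DD IHn lenard_D1 addr0. Qed.

Lemma lenard_Dsum n (f : nat -> A) : D (\sum_(i < n) f i) = \sum_(i < n) D (f i).
Proof. by rewrite (big_morph D DD lenard_D0). Qed.

Lemma sum_antidiag n (f : nat -> nat -> A) :
  \sum_(i < n.+1) f i (n - i)%N = \sum_(i < n.+1) f (n - i)%N i.
Proof.
rewrite (reindex_inj rev_ord_inj) /=; apply: eq_bigr => i _.
by rewrite subSS subKn // -ltnS.
Qed.

Lemma lenard_seqP k : D (lenard_seq k.+1) =
  D (D (D (lenard_seq k))) + 4 * u * D (lenard_seq k)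
  + 2 * D u * lenard_seq k.
Proof.
pose L := lenard_seq.
pose T x := D (D (D x)) + 4 * u * D x + 2 * D u * x.
rewrite -/(T (lenard_seq k)) -/L.
have [m] := ubnP k; elim: m k => // m IHm k; rewrite ltnS => le_km.
pose I i j := D (2 * L i * D (D (L j)) - D (L i) * D (L j) + 4 * u * L i * L j).
pose J i j := D (L i) * D (D (L j)) + 4 * u * D (L i) * L j.
have IE i j : I i j = 2 * L i * T (L j) + (J i j - J j i).
  rewrite /I /J /T !DD lenard_DN !DM !lenard_Dnat; ring.
have -> : L k.+1 = \sum_(i < k.+1) (2 * L i * D (D (L (k - i)%N))
    - D (L i) * D (L (k - i)%N) + 4 * u * L i * L (k - i)%N)
    - \sum_(i < k) L i.+1 * L (k - i)%N by exact: lenard_seqS.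
rewrite DD lenard_DN.
rewrite (lenard_Dsum _ (fun i => 2 * L i * D (D (L (k - i)%N))
    - D (L i) * D (L (k - i)%N) + 4 * u * L i * L (k - i)%N)).
rewrite (lenard_Dsum _ (fun i => L i.+1 * L (k - i)%N)).
under eq_bigr => i _ do rewrite -/(I i (k - i)%N) IE.
rewrite big_split /= sumrB (sum_antidiag _ J) subrr addr0.
rewrite big_ord_recl /= subn0.
have -> : L 0%N = h by [].
rewrite h2 mul1r -addrA -[RHS]addr0; congr (_ + _); apply/eqP.
rewrite subr_eq0; apply/eqP.
have E : \sum_(i < k) D (L i.+1) * L (k - i)%N =
         \sum_(i < k) L i.+1 * D (L (k - i)%N).
  case: k {le_km} => [|k]; first by rewrite !big_ord0.
  under eq_bigr => i _ do rewrite subSn -1?ltnS //.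
  rewrite (sum_antidiag k (fun i j => D (L i.+1) * L j.+1)).
  by apply: eq_bigr => i _; rewrite subSn -1?ltnS // mulrC.
under [RHS]eq_bigr => i _ do rewrite DM.
rewrite big_split /= E -big_split /=; apply: eq_bigr => i _.
rewrite /bump /= add1n -IHm; last first.
  by rewrite (leq_trans _ le_km) // ltn_subrL /= (leq_ltn_trans _ (ltn_ord i)).
by rewrite -subSn // subSS -mulrA mulr_natl mulr2n.
Qed.

Lemma lenard_seq_eps (B : nzRingType) (e : {rmorphism A -> B}) k :
  e u = 0 -> (forall x, e (D x) = 0) -> e (lenard_seq k.+1) = 0.
Proof.
move=> eu eD; have [m] := ubnP k; elim: m k => // m IHm k; rewrite ltnS => le_km.
rewrite lenard_seqS rmorphB !rmorph_sum /= !big1 ?subr0 // => i _.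
  by rewrite rmorphM IHm ?mul0r // (leq_trans _ le_km).
by rewrite !(rmorphD, rmorphM, rmorphN) /= !eD eu !(mulr0, mul0r) oppr0 !addr0.
Qed.

End LenardExistence.

Lemma mcoeff1_uvar (F : fieldType) i : mcoeff mone (uvar F i) = 0.
Proof. by rewrite mcoeffU1 cm1_eq1. Qed.

Lemma mcoeff1_dpderiv (F : fieldType) (P : diffpoly F) :
  mcoeff mone (dpderiv P) = 0.
Proof.
elim/malg_ind: P => [c m|P Q IHP IHQ]; last first.
  by rewrite (dpderivD P) (mcoeffD _ (dpderiv P)) [X in X + _]IHP [X in _ + X]IHQ addr0.
rewrite dpderivU mcoeffZ [X in _ * X](_ : _ = 0) ?mulr0 //.
rewrite /monderiv raddf_sum big1 //= => i _.
by rewrite (mcoeff1M _ (uvar F i.+1)) mcoeff1_uvar mulr0.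
Qed.

Lemma ratderiv0 (F : fieldType) : ratderiv (0 : {fraction {poly F}}) = 0.
Proof.
have := ratderivE 0 (oner_neq0 {poly F}).
by rewrite tofrac0 mul0r deriv0 !mul0r subrr tofrac0 mul0r.
Qed.

Lemma dpsubst0 (F : fieldType) (P : diffpoly F) :
  dpsubst P 0 = (mcoeff mone P)%:P%:F.
Proof.
have iter0 i : iter i (@ratderiv F) 0 = 0.
  by elim: i => //= i ->; exact: ratderiv0.
elim/malg_ind: P => [c m|P Q IHP IHQ]; last first.
  by rewrite /dpsubst mmapD raddfD /= !rmorphD /= -IHP -IHQ.
rewrite /dpsubst mmapU mcoeffU /=; have [->|m1] := eqVneq m mone.
  by rewrite mdom1 big_seq_fset0 mulr1.
have /fset0Pn[i im] : finsupp m != fset0.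
  apply: contraNneq m1 => m0; apply/cmP => i; rewrite cm1.
  by apply/eqP; rewrite cmE_eq0 m0 inE.
rewrite (big_fsetD1 i) //= iter0 expr0n cmE_eq0 im mul0r mulr0.
by rewrite mulr0n polyC0 tofrac0.
Qed.

Lemma malg_half (F : numFieldType) (K : monomType) :
  2 * (2^-1)%:MP = 1 :> {malg F[K]}.
Proof. by rewrite -mpolyC_nat -mpolyCM divff ?pnatr_eq0. Qed.

Lemma lenard_exists (F : numFieldType) : exists L, @is_lenard F L.
Proof.
have h2 := malg_half F (cmonom nat).
exists (lenard_seq (@dpderiv F) (uvar F 0) (2^-1)%:MP); split.
- reflexivity.
- move=> k; rewrite -[uvar F 1]dpderivX.
  exact: (@lenard_seqP _ _ _ _ (@dpderivD F) (@dpderivM F) h2 k).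
- move=> [//|k] _; rewrite dpsubst0.
  rewrite (lenard_seq_eps _ (e := mcoeff mone)).
  + by rewrite polyC0 tofrac0.
  + exact: mcoeff1_uvar.
  + exact: mcoeff1_dpderiv.
Qed.

Definition lenard (F : numFieldType) : nat -> diffpoly F :=
  projT1 (cid (lenard_exists F)).

Lemma lenardP (F : numFieldType) : is_lenard (@lenard F).
Proof. exact: projT2 (cid (lenard_exists F)). Qed.

(* t_(2 k + 1) for 1 <= k <= N; the sequence t lists t_3, t_5, ..., t_(2 N - 1),
   and t_(2 N + 1) = - 1 / (2 N + 1). *)
Definition oddtime (F : numFieldType) (N : nat) (t : (N.-1).-tuple F) (k : nat) :
    F :=
  if k == N then - (2 * N + 1)%:R^-1 else t`_k.-1.

Definition vy_next (F : numFieldType) (N : nat) (t : (N.-1).-tuple F)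
    (q0 q1 : {fraction {poly F}}) : {fraction {poly F}} :=
  let u := 2 * d2ln q1 in
  q1 ^+ 2 *
    ('X%:F - 2 * dpsubst (lenard F N) u
     + 2 * \sum_(1 <= k < N)
             ((2 * k + 1)%:R * oddtime t k)%:P%:F * dpsubst (lenard F k) u)
  / q0.

(* The recurrence is solved for Q_(n+1) in the field of rational functions; that
   every Q_n is a (nonzero) polynomial is not built in. *)
Fixpoint vy_pair (F : numFieldType) (N : nat) (t : (N.-1).-tuple F) (n : nat) :
    {fraction {poly F}} * {fraction {poly F}} :=
  if n is n'.+1 then
    let: (q0, q1) := vy_pair t n' in (q1, vy_next t q0 q1)
  else (1, 'X%:F).

Definition genVY (F : numFieldType) (N : nat) (t : (N.-1).-tuple F) (n : nat) :
    {fraction {poly F}} :=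
  (vy_pair t n).1.

(* A sequence (t_1, t_2, ...) is a function on nat whose value at 0 is ignored.
   exp_trunc K t agrees with exp (\sum_(j >= 1) t_j z^j) up to z^K. *)
Definition exp_trunc (F : fieldType) (K : nat) (t : nat -> F) : {poly F} :=
  \sum_(m < K.+1) (m`!%:R)^-1 *: (\sum_(1 <= j < K.+1) t j *: 'X^j) ^+ m.

Lemma exp_trunc_stable (F : fieldType) (t : nat -> F) (k K : nat) :
  (k <= K)%N -> (exp_trunc K t)`_k = (exp_trunc k t)`_k.
Proof.
pose p n : {poly F} := \sum_(1 <= j < n.+1) t j *: 'X^j.
have coefp n i : (p n)`_i = if (0 < i <= n)%N then t i else 0.
  rewrite /p coef_sum; under eq_bigr => j _ do rewrite coefZ coefXn.
  case: ifPn => [/andP[i0 lei]|ni].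
    rewrite (bigD1_seq i) ?mem_index_iota ?iota_uniq ?i0 ?ltnS //= eqxx mulr1.
    by rewrite big1 ?addr0 // => j /negPf ji; rewrite eq_sym ji mulr0.
  rewrite big1_seq // => j; rewrite mem_index_iota ltnS => /andP[_ jn].
  by have [ij|] := eqVneq i j; [rewrite ij jn in ni|rewrite mulr0].
have coefpX n m i : (i < m)%N -> (p n ^+ m)`_i = 0.
  elim: m i => // m IHm i; rewrite ltnS => im.
  rewrite exprS coefM big1 // => -[[|j] /= ji] _.
    by rewrite coefp mul0r.
  rewrite IHm ?mulr0 // (leq_trans _ im) // ltn_subrL /=.
  exact: leq_ltn_trans (leq0n j) ji.
move=> kK; have coefpE m i : (i <= k)%N -> (p K ^+ m)`_i = (p k ^+ m)`_i.
  elim: m i => [|m IHm] i ik; first by rewrite !expr0.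
  rewrite !exprS !coefM; apply: eq_bigr => -[j /= ji] _.
  have jk : (j <= k)%N by rewrite (leq_trans _ ik).
  by rewrite IHm ?(leq_trans (leq_subr _ _)) // !coefp jk (leq_trans jk kK).
rewrite /exp_trunc -/(p K) -/(p k) !coef_sum.
rewrite (big_ord_widen K.+1 (fun m => ((m`!%:R)^-1 *: p k ^+ m)`_k)) ?ltnS //.
rewrite [RHS]big_mkcond /=; apply: eq_bigr => m _.
rewrite !coefZ coefpE //; case: ifPn => //; rewrite -leqNgt => km.
by rewrite coefpX ?mulr0.
Qed.

Definition hschur (F : fieldType) (t : nat -> F) (k : int) : F :=
  if k is Posz k' then (exp_trunc k' t)`_k' else 0.

Definition schur (F : fieldType) (la : seq nat) (t : nat -> F) : F :=
  \det (\matrix_(j < size la, k < size la)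
          hschur t ((nth 0%N la j)%:Z - j%:Z + k%:Z)).

Definition staircase (n : nat) : seq nat := rev (iota 1 n).

(* (x, 0, 2^2 t_3, 0, 2^4 t_5, ..., 2^(2 N) t_(2 N + 1), 0, 0, ...) *)
Definition schur_arg (F : numFieldType) (N : nat) (t : (N.-1).-tuple F) (x : F)
    (i : nat) : F :=
  if i == 1%N then x
  else if odd i && (0 < i./2 <= N)%N then 2 ^+ (2 * i./2) * oddtime t i./2
  else 0.

(* Main.v *)
Require Import Defs.
From HB Require Import structures.
From mathcomp Require Import all_boot all_order all_algebra.
From mathcomp Require Import complex reals finmap perm ring zify.
From mathcomp.multinomials Require Import monalg.

Set Implicit Arguments.
Unset Strict Implicit.
Unset Printing Implicit Defensive.

Import GRing.Theory Num.Theory.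
Local Open Scope ring_scope.

(* Let h_k be the coefficients of E(z) = exp(x z + t_3' z^3 + ...), t_j' being the
   rescaled times, so that (h_k)'' = h_(k-2). Iterated Darboux transformations
   g_0 = h, psi_n = g_n(2n+1), g_(n+1) = g_n' - (psi_n'/psi_n) g_n preserve the
   relation g'' + u g = shifted g, with u_n = 2 (ln tau_n)'' and
   tau_n = psi_0 ... psi_(n-1). They are also encoded by monic polynomials
   W_n(z) of degree n through sum_k g_n(k) z^k = W_n E. This makes the Schur
   determinant unitriangularly equivalent to a triangular matrix with diagonal
   psi_j, hence equal to tau_n. The product R = W_n(z) W_n(-z) satisfies the
   Lenard third-order equation with spectral parameter z^2, so its coefficients
   are the L_k[u_n], the constants of integration being fixed at x = oo. Since
   E(z) E(-z) = 1 and E' = A E, the coefficient of z^(2n) in A R is that of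
   G'(z) G(-z) with G = W_n E, and almost all terms of the latter vanish; this is
   the Vorob'ev-Yablonski recurrence for tau_n. *)

(** * Coefficients of products and of p(-z) *)

Lemma coefM_eq (R : nzRingType) (r p q : {poly R}) k :
  (forall i, (i <= k)%N -> p`_i = q`_i) -> (r * p)`_k = (r * q)`_k.
Proof. by move=> E; rewrite !coefM; apply: eq_bigr => i _; rewrite E ?leq_subr. Qed.

Lemma coef_comp_polyNX (R : comNzRingType) (p : {poly R}) k :
  (p \Po - 'X)`_k = (-1) ^+ k * p`_k.
Proof.
elim/poly_ind: p k => [|p c IHp] k; first by rewrite comp_poly0 !coef0 mulr0.
rewrite comp_polyD comp_polyM comp_polyX comp_polyC mulrN.
rewrite !(coefD, coefN, coefMX, coefC); case: k => [|k] /=; first by ring.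
by rewrite IHp exprS; ring.
Qed.

(** * A derivation in x acting on the coefficients of polynomials in z *)

Section Darboux.
Variables (K : fieldType) (D : K -> K).
Hypothesis DD : {morph D : x y / x + y}.
Hypothesis DM : forall x y, D (x * y) = D x * y + x * D y.

Let D0 : D 0 = 0 := lenard_D0 DD.
Let DN : {morph D : x / - x} := lenard_DN DD.
Let D1 : D 1 = 0 := lenard_D1 DM.
Let Dnat n : D n%:R = 0 := lenard_Dnat DD DM n.

Let DsignM k x : D ((-1) ^+ k * x) = (-1) ^+ k * D x.
Proof. by rewrite -signr_odd; case: (odd k); rewrite ?(expr1, expr0) ?mul1r // !mulN1r DN. Qed.

Local Notation "p ^'D" := (map_poly D p) (at level 2, format "p ^'D").

Lemma coef_mapD p k : p^'D`_k = D p`_k.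
Proof. exact: coef_map_id0. Qed.

Lemma mapDD p q : (p + q)^'D = p^'D + q^'D.
Proof. by apply/polyP => k; rewrite !(coefD, coef_mapD) DD. Qed.

Lemma mapDN p : (- p)^'D = - p^'D.
Proof. by apply/polyP => k; rewrite !(coefN, coef_mapD) DN. Qed.

Lemma mapDM p q : (p * q)^'D = p^'D * q + p * q^'D.
Proof.
apply/polyP => k; rewrite !(coefD, coef_mapD, coefM).
rewrite (big_morph D DD D0) -big_split /=.
by apply: eq_bigr => i _; rewrite DM !coef_mapD.
Qed.

Lemma mapDC c : (c%:P)^'D = (D c)%:P.
Proof. by apply/polyP => k; rewrite coef_mapD !coefC; case: ifP. Qed.

Lemma mapDX : ('X)^'D = 0 :> {poly K}.
Proof. by apply/polyP => k; rewrite coef_mapD coefX coef0 Dnat. Qed.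

Lemma mapD_compNX p : (p \Po - 'X)^'D = p^'D \Po - 'X.
Proof. by apply/polyP => k; rewrite coef_mapD !coef_comp_polyNX coef_mapD DsignM. Qed.

(* The product of two solutions of f'' = q f satisfies
   r''' = 4 q r' + 2 q' r; here f is W(z) e^(xz) and q is z^2 - u. *)
Lemma product_ode (u : K) (W : {poly K}) (R := W * (W \Po - 'X)) :
  (W^'D)^'D + 'X *+ 2 * W^'D + u%:P * W = 0 ->
  ((R^'D)^'D)^'D + 4 * u%:P * R^'D + 2 * (D u)%:P * R = 4 * 'X ^+ 2 * R^'D.
Proof.
move=> E.
(* V solves the equation with z replaced by -z; the two equations eliminate second derivatives from
   R'''. *)
pose V := W \Po - 'X.
have E' : (V^'D)^'D - 'X *+ 2 * V^'D + u%:P * V = 0.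
  rewrite !mapD_compNX; have := congr1 (fun p => p \Po - 'X) E.
  rewrite mulr2n !(comp_polyD, comp_polyM, comp_polyX, comp_polyC, comp_poly0).
  by rewrite -opprD mulNr.
have W2 : (W^'D)^'D = - ('X *+ 2 * W^'D + u%:P * W).
  by apply/eqP; rewrite -addr_eq0 addrA E.
have V2 : (V^'D)^'D = 'X *+ 2 * V^'D - u%:P * V.
  by apply/eqP; rewrite -subr_eq0 -E'; apply/eqP; ring.
have X2 : ('X *+ 2)^'D = 0 :> {poly K} by rewrite mulr2n mapDD mapDX addr0.
rewrite /R -/V !(mapDM, mapDD, W2, V2, mapDN, mapDC, X2); ring.
Qed.

(** * Iterated Darboux transformations *)

Section Iteration.
Variable h : nat -> K.
Hypothesis h0 : h 0%N = 1.
Hypothesis Dh : forall k, D (h k.+1) = h k.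

(** The seed g_n(2n+1) is the first odd-indexed entry not killed by earlier steps; [dpsi_neq0] makes
    the quotient genuine. *)
Fixpoint darboux n : nat -> K :=
  if n is n'.+1 then
    let g := darboux n' in
    fun k => D (g k) - D (g (2 * n' + 1)%N) / g (2 * n' + 1)%N * g k
  else h.

Definition dpsi n := darboux n (2 * n + 1)%N.
Definition dlog n := D (dpsi n) / dpsi n.
Definition dpot n := \sum_(i < n) 2 * D (dlog i).

Lemma darbouxS n k : darboux n.+1 k = D (darboux n k) - dlog n * darboux n k.
Proof. by []. Qed.

Lemma dpotS n : dpot n.+1 = dpot n + 2 * D (dlog n).
Proof. exact: big_ord_recr. Qed.

Definition dshift (f : nat -> K) k := if k is k'.+2 then f k' else 0.

(** Here psi_n'' + u_n psi_n = 0; putting psi_n' = y psi_n and cancelling psi_n leaves the Riccati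
    equation for y. *)
Lemma riccati_step n : dpsi n != 0 ->
  (forall m, (m < n)%N -> darboux n (2 * m + 1)%N = 0) ->
  (forall k, D (D (darboux n k)) + dpot n * darboux n k = dshift (darboux n) k) ->
  D (dlog n) + dlog n ^+ 2 = - dpot n.
Proof.
move=> psi0 g0 gL.
have yE : D (dpsi n) = dlog n * dpsi n by rewrite divfK.
have psiL : D (D (dpsi n)) + dpot n * dpsi n = 0.
  (* The shift takes 2n+1 to 2n-1, where g_n vanishes; for n = 0 it is 0 by definition. *)
  rewrite gL; case: n g0 {psi0 gL yE} => [//|n] g0.
  by have -> : (2 * n.+1 + 1 = (2 * n + 1).+2)%N; [lia|exact: g0].
apply: (mulIf psi0); apply/eqP; rewrite -subr_eq0 -psiL yE DM yE; apply/eqP; ring.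
Qed.

(* D^2 + u_n = (D + y)(D - y) and D^2 + u_(n+1) = (D - y)(D + y) for y = dlog n. *)
Lemma darboux_invariants n :
  [/\ dpsi n != 0, forall m, (m < n)%N -> darboux n (2 * m + 1)%N = 0
   & forall k, D (D (darboux n k)) + dpot n * darboux n k = dshift (darboux n) k].
Proof.
have Dh0 : D (h 0) = 0 by rewrite h0.
elim: n => [|n [psi0 g0 gL]].
  have h1 : h 1 != 0.
    by apply/eqP => h10; have := Dh 0; rewrite h10 D0 h0 => /esym/eqP; rewrite oner_eq0.
  split=> // -[|[|k]] /=; rewrite /dpot big_ord0 mul0r addr0 ?Dh ?Dh0 //.
have yE : D (dpsi n) = dlog n * dpsi n by rewrite divfK.
have riccati := riccati_step psi0 g0 gL.
have factor k : D (darboux n.+1 k) + dlog n * darboux n.+1 k = dshift (darboux n) k.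
  rewrite -gL darbouxS DD DN DM; apply/eqP; rewrite -subr_eq0.
  have -> : dpot n = - (D (dlog n) + dlog n ^+ 2) by rewrite riccati opprK.
  by apply/eqP; ring.
split.
(* At index 2n+3, [factor] reads psi_(n+1)' + y psi_(n+1) = psi_n, which is nonzero. *)
- apply/eqP => psiS0; have := factor (2 * n.+1 + 1)%N; rewrite -/(dpsi n.+1) psiS0.
  by rewrite D0 mulr0 addr0 mulnS /= => /esym/eqP; apply/negP.
(* The zero at m = n is new: D - y annihilates psi_n. *)
- move=> m; rewrite ltnS leq_eqVlt darbouxS => /predU1P[->|lt_mn].
    by rewrite -/(dpsi n) yE subrr.
  by rewrite g0 // D0 mulr0 subrr.
move=> k.
(* The shift commutes with D - y, so applying D - y to [factor] gives the relation for n+1. *)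
have -> : dshift (darboux n.+1) k = D (dshift (darboux n) k) - dlog n * dshift (darboux n) k.
  by case: k => [|[|k]] //=; rewrite D0 mulr0 subrr.
rewrite -factor dpotS.
have -> : dpot n = - (D (dlog n) + dlog n ^+ 2) by rewrite riccati opprK.
move: (darboux n.+1 k) (dlog n) => phi y; rewrite !DD !DM; rewrite -[2]/(1 + 1); ring.
Qed.

Lemma dpsi_neq0 n : dpsi n != 0.
Proof. by have [] := darboux_invariants n. Qed.

Lemma darboux_odd n m : (m < n)%N -> darboux n (2 * m + 1)%N = 0.
Proof. by have [_ g0 _] := darboux_invariants n; exact: g0. Qed.

Lemma dlog_riccati n : D (dlog n) + dlog n ^+ 2 = - dpot n.
Proof. by have [? ? ?] := darboux_invariants n; exact: riccati_step. Qed.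

(** As dE/dx = z E, the operator D - y_n sends W E to (W' + z W - y_n W) E. *)
Fixpoint dpoly n : {poly K} :=
  if n is n'.+1 then (dpoly n')^'D + 'X * dpoly n' - (dlog n')%:P * dpoly n' else 1.

Lemma mapD1 : (1 : {poly K})^'D = 0.
Proof. by rewrite mapDC D1. Qed.

Lemma dpoly_coef_high n k : (n < k)%N -> (dpoly n)`_k = 0.
Proof.
elim: n k => [|n IHn] k ltnk; first by rewrite coef1; case: k ltnk.
rewrite /= !(coefD, coefN, coef_mapD, coefXM, coefCM) !IHn; try lia.
by rewrite D0 if_same; ring.
Qed.

Lemma dpoly_lead n : (dpoly n)`_n = 1.
Proof.
elim: n => [|n IHn]; first by rewrite coef1.
rewrite /= !(coefD, coefN, coef_mapD, coefXM, coefCM) /= IHn.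
rewrite dpoly_coef_high // D0; ring.
Qed.

(** Equivalently, W_n e^(xz) solves f'' + u_n f = z^2 f, an equation that D - y_n carries from u_n
    to u_(n+1). *)
Lemma dpoly_ode n :
  ((dpoly n)^'D)^'D + 'X *+ 2 * (dpoly n)^'D + (dpot n)%:P * dpoly n = 0.
Proof.
elim: n => [|n IHn].
  by rewrite /= mapD1 mapDC D0 /dpot big_ord0 polyC0; ring.
have := dlog_riccati n; rewrite dpotS /= -[2]/(1 + 1).
move: IHn; move: (dpot n) (dlog n) (dpoly n) => u y W IHn riccati.
have uE : u%:P = - ((D y)%:P + y%:P ^+ 2).
  by rewrite -polyC_exp -polyCD riccati polyCN opprK.
have W2 : (W^'D)^'D = - ('X *+ 2 * W^'D + u%:P * W).
  by apply/eqP; rewrite -addr_eq0 addrA IHn.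
have X0 : ('X)^'D = 0 :> {poly K} := mapDX.
rewrite !(mapDD, mapDN, mapDM, mapDC, X0, W2).
have DuE : (D u)%:P = - ((D (D y))%:P + y%:P * (D y)%:P *+ 2).
  rewrite -[u]opprK -riccati expr2 DN DD DM !(polyCN, polyCD, polyCM); ring.
rewrite !(polyCD, polyCM) uE DuE ?D0 polyC0 polyC1; ring.
Qed.

(** Truncating E at z^M does not affect the coefficients below M. *)
Lemma darbouxE n M k : (k < M)%N -> (dpoly n * \poly_(i < M) h i)`_k = darboux n k.
Proof.
elim: n k => [|n IHn] k ltkM; first by rewrite mul1r coef_poly ltkM.
rewrite darbouxS -!IHn // -coef_mapD -coefCM -coefB mapDM /= mulrBl mulrDl.
rewrite -[_%:P * _ * _]mulrA !coefB !coefD; congr (_ + _ - _).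
rewrite ['X * _]mulrC -mulrA; apply: coefM_eq => i leik.
rewrite coef_mapD coefXM !coef_poly (leq_ltn_trans leik ltkM).
by case: i leik => [|i] leik /=; rewrite ?h0 ?D1 // Dh ifT //; lia.
Qed.

Lemma dpsiS n : D (dpsi n.+1) + dlog n * dpsi n.+1 = dpsi n.
Proof.
have [_ _ gL] := darboux_invariants n.
have -> : dpsi n = dshift (darboux n) (2 * n.+1 + 1)%N by rewrite mulnS.
rewrite -gL /dpsi darbouxS DD DN DM.
have -> : dpot n = - (D (dlog n) + dlog n ^+ 2) by rewrite dlog_riccati opprK.
ring.
Qed.

(** By [dpsiS], y_(n+1) = psi_n / psi_(n+1) - y_n, so D - y_(n+1) maps 1/psi_n to -1/psi_(n+1). This
    value supplies the division by psi_n in the recurrence. *)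
Lemma darboux_at0 n : darboux n.+1 0%N = (-1) ^+ n.+1 / dpsi n.
Proof.
have DV x : x != 0 -> D x^-1 = - (D x / x) / x.
  move=> x0; apply: (mulfI x0); apply: (addrI (D x * x^-1)).
  by rewrite -DM divff // D1 mulrCA divff // mulr1 subrr.
elim: n => [|n IHn].
  by rewrite darbouxS /dlog /dpsi /= h0 D1 (Dh 0) h0 expr1; ring.
rewrite darbouxS IHn DsignM DV ?dpsi_neq0 // -/(dlog n) [in RHS]exprS mulN1r.
have -> : dlog n.+1 = (dpsi n - dlog n * dpsi n.+1) / dpsi n.+1.
  by rewrite -(dpsiS n) addrK.
have := dpsi_neq0 n; have := dpsi_neq0 n.+1.
move: (dpsi n) (dpsi n.+1) (dlog n) ((-1) ^+ n.+1) => p q y c q0 p0; field.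
by rewrite p0 q0.
Qed.

(** * The logarithmic z-derivative A of E, and the coefficient of z^(2n) in A R *)

Section Recurrence.
Variable a : nat -> K.
Hypothesis char0 : forall k, k.+1%:R != 0 :> K.
Hypothesis a_odd : forall k, odd k -> a k = 0.
Hypothesis hE : forall k, h k.+1 *+ k.+1 = \sum_(j < k.+1) a j * h (k - j).

Section Truncation.
Variable M : nat.
(** Power series are cut off at z^M; differentiation in z costs one coefficient, whence the bounds k
    + 1 < M. *)
Let E := \poly_(i < M) h i.
Let A := \poly_(i < M) a i.

Let A_even : A \Po - 'X = A.
Proof.
apply/polyP => k; rewrite coef_comp_polyNX coef_poly -signr_odd.
by have [/a_odd->|_] := boolP (odd k); rewrite ?if_same ?mulr0 // expr0 mul1r.
Qed.

Let derivE k : (k.+1 < M)%N -> E^`()`_k = (A * E)`_k.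
Proof.
move=> ltk; rewrite coef_deriv coef_poly ltk hE coefM; apply: eq_bigr => j _.
by have := ltn_ord j; rewrite !coef_poly => ltj; rewrite !ifT //; lia.
Qed.

Let derivNE k : (k.+1 < M)%N -> (E^`() \Po - 'X)`_k = (A * (E \Po - 'X))`_k.
Proof.
by move=> ltk; rewrite -[in RHS]A_even -comp_polyM !coef_comp_polyNX derivE.
Qed.

(** A is even, so E(z) E(-z) has z-derivative 0; in characteristic 0 only the constant term h_0^2 =
    1 remains. *)
Lemma exp_odd_inv k : (k < M)%N -> (E * (E \Po - 'X))`_k = (k == 0)%:R.
Proof.
case: k => [|k] ltk.
  by rewrite coef0M coef_comp_polyNX coef_poly ltk h0 mul1r mulr1.
apply: (mulIf (char0 k)); rewrite mulr_natr -coef_deriv derivM deriv_comp.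
rewrite derivN derivX mulrN1 mulrN coefB mul0r [_^`() * _]mulrC.
apply/eqP; rewrite subr_eq0; apply/eqP.
transitivity (((E \Po - 'X) * (A * E))`_k).
  by apply: coefM_eq => i leik; rewrite derivE //; lia.
transitivity ((E * (A * (E \Po - 'X)))`_k); first by
  apply: (congr1 (fun p : {poly K} => p`_k)); ring.
by apply: coefM_eq => i leik; rewrite derivNE //; lia.
Qed.

(** For G = W E, G'(z) G(-z) = W'(z) W(-z) + A R, and the first summand does not reach z^(2n). On
    the left, g_n(i+1) is paired with g_n(2n-i); unless i = 2n, one index is odd and below 2n+1, so
    the product vanishes. *)
Lemma darboux_key n : (2 * n + 1 < M)%N ->
  (A * (dpoly n * (dpoly n \Po - 'X)))`_(2 * n) = (2 * n + 1)%:R * dpsi n * darboux n 0.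
Proof.
move=> ltnM; set W := dpoly n; set V := W \Po - 'X.
have WV0 : (W^`() * V)`_(2 * n) = 0.
  rewrite coefM big1 // => i _; rewrite coef_deriv coef_comp_polyNX.
  have [lein|ltin] := ltnP i n.
    by rewrite [W`_(2 * n - i)]dpoly_coef_high ?mulr0 //; lia.
  by rewrite dpoly_coef_high ?mul0rn ?mul0r //; lia.
pose G := W * E.
have GG : (G^`() * (G \Po - 'X))`_(2 * n) = (2 * n + 1)%:R * dpsi n * darboux n 0.
  rewrite coefM (bigD1 (@Ordinal (2 * n).+1 (2 * n) (ltnSn _))) //= subnn.
  rewrite coef_deriv coef_comp_polyNX expr0 mul1r !darbouxE; try lia.
  rewrite big1 ?addr0 => [|i ni]; first by rewrite /dpsi addn1 mulr_natl.
  have {ni} ltin : (i < 2 * n)%N by have := ltn_ord i; rewrite -val_eqE /= in ni; lia.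
  rewrite coef_deriv coef_comp_polyNX !darbouxE; try lia.
  have [oi|ei] := boolP (odd i).
    have -> : (2 * n - i = 2 * (n - i./2).-1 + 1)%N by lia.
    by rewrite darboux_odd ?mulr0 //; lia.
  have -> : (i.+1 = 2 * i./2 + 1)%N by lia.
  by rewrite darboux_odd ?mul0rn ?mul0r //; lia.
rewrite -{}GG derivM comp_polyM mulrDl coefD.
have -> : (W^`() * E * ((W \Po - 'X) * (E \Po - 'X)))`_(2 * n) = 0.
  transitivity ((W^`() * V * 1)`_(2 * n)); last by rewrite mulr1.
  transitivity ((W^`() * V * (E * (E \Po - 'X)))`_(2 * n)).
    by apply: (congr1 (fun p : {poly K} => p`_(2 * n))); rewrite /V; ring.
  by apply: coefM_eq => i lei; rewrite exp_odd_inv ?coef1 //; lia.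
rewrite add0r.
transitivity ((A * (W * V) * (E * (E \Po - 'X)))`_(2 * n)).
  transitivity ((A * (W * V) * 1)`_(2 * n)); first by
    apply: (congr1 (fun p : {poly K} => p`_(2 * n))); ring.
  by apply: coefM_eq => i lei; rewrite exp_odd_inv ?coef1 //; lia.
transitivity ((W * V * (E \Po - 'X) * (A * E))`_(2 * n)).
  by apply: (congr1 (fun p : {poly K} => p`_(2 * n))); ring.
transitivity ((W * V * (E \Po - 'X) * E^`())`_(2 * n)).
  by apply: coefM_eq => i lei; rewrite derivE //; lia.
by apply: (congr1 (fun p : {poly K} => p`_(2 * n))); rewrite /V; ring.
Qed.
End Truncation.
End Recurrence.

(* Right multiplication by the unitriangular matrix [z^l] W_k is the k-th Darboux
   transformation, whose image vanishes above the diagonal. *)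
Lemma det_darboux n :
  \det (\matrix_(j < n, k < n) (if (k <= 2 * j + 1)%N then h (2 * j + 1 - k) else 0))
  = \prod_(i < n) dpsi i.
Proof.
set H := \matrix_(j, k) _.
pose U : 'M[K]_n := \matrix_(l, k) (dpoly k)`_l.
have UE : \det U = 1.
  rewrite -det_tr det_trig; first by rewrite big1 // => i _; rewrite !mxE dpoly_lead.
  by apply/is_trig_mxP => i j ltij; rewrite !mxE dpoly_coef_high.
have HUE j k : (H *m U) j k = darboux k (2 * j + 1)%N.
  rewrite mxE -(@darbouxE k (2 * j + 1).+1) // mulrC coefM.
  pose f l := (if (l <= 2 * j + 1)%N then h (2 * j + 1 - l) else 0) * (dpoly k)`_l.
  transitivity (\sum_(l < n) f l); first by apply: eq_bigr => l _; rewrite !mxE.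
  pose m := maxn n (2 * j + 1).+1.
  rewrite (big_ord_widen m f (leq_maxl _ _)) big_mkcond /=.
  transitivity (\sum_(l < m) f l).
    apply: eq_bigr => l _; case: ltnP => // lenl.
    by rewrite /f dpoly_coef_high ?mulr0 // (leq_trans (ltn_ord k)).
  pose g l := h (2 * j + 1 - l) * (dpoly k)`_l.
  transitivity (\sum_(l < (2 * j + 1).+1) g l).
    rewrite (big_ord_widen m g (leq_maxr _ _)) [RHS]big_mkcond /=.
    by apply: eq_bigr => l _; rewrite ltnS /f; case: ifP => //; rewrite mul0r.
  rewrite (reindex_inj rev_ord_inj) /=; apply: eq_bigr => l _.
  have := ltn_ord l; rewrite ltnS => lel.
  by rewrite /g subSS subKn // coef_poly ltnS lel.
have <- : \det (H *m U) = \det H by rewrite det_mulmx UE mulr1.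
rewrite det_trig.
  by apply: eq_bigr => i _; rewrite HUE.
by apply/is_trig_mxP => j k ltjk; rewrite HUE darboux_odd.
Qed.

(** * The product R and its third-order equation *)

Definition resolvent n := dpoly n * (dpoly n \Po - 'X).

Lemma resolvent_lead n : (resolvent n)`_(2 * n) = (-1) ^+ n.
Proof.
have ltn : (n < (2 * n).+1)%N by lia.
rewrite coefM (bigD1 (Ordinal ltn)) //=; have -> : (2 * n - n = n)%N by lia.
rewrite coef_comp_polyNX dpoly_lead mul1r mulr1 big1 ?addr0 // => i ni.
have {ni} ni : i != n :> nat by rewrite -val_eqE in ni.
rewrite coef_comp_polyNX; have [ltin|lein] := ltnP i n.
  by rewrite [X in _ * (_ * X)]dpoly_coef_high ?mulr0 //; lia.
by rewrite dpoly_coef_high ?mul0r //; lia.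
Qed.

(** The Lenard recursion, with indices descending from the top coefficient of R. *)
Lemma resolvent_ode n k (r := fun k => (resolvent n)`_(2 * k)) :
  D (D (D (r k.+1))) + 4 * dpot n * D (r k.+1) + 2 * D (dpot n) * r k.+1
  = 4 * D (r k).
Proof.
have := congr1 (fun p : {poly K} => p`_(2 * k.+1)) (product_ode (dpoly_ode n)).
rewrite -/(resolvent n) /r.
have N c p i : (c%:R * p : {poly K})`_i = c%:R * p`_i.
  by rewrite -polyC_natr coefCM.
rewrite -!mulrA !coefD !N !coefCM !coef_mapD. rewrite !coefXM coef_mapD => ->.
by rewrite mulnS.
Qed.

(** 4 z^2 R' has no constant term; this is why L_k[u_n] = 0 for k > n. *)
Lemma resolvent_ode0 n (r0 := (resolvent n)`_0) :
  D (D (D r0)) + 4 * dpot n * D r0 + 2 * D (dpot n) * r0 = 0.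
Proof.
have := congr1 (fun p : {poly K} => p`_0) (product_ode (dpoly_ode n)).
rewrite -/(resolvent n) /r0.
have N c p i : (c%:R * p : {poly K})`_i = c%:R * p`_i.
  by rewrite -polyC_natr coefCM.
by rewrite -!mulrA !coefD !N !coefCM !coef_mapD !coefXM mulr0.
Qed.

(** * Lower coefficients of W_n and R under an abstract notion of vanishing at infinity *)

Section Small.
Variable small : K -> Prop.
Hypothesis small0 : small 0.
Hypothesis smallD : forall x y, small x -> small y -> small (x + y).
Hypothesis smallN : forall x, small x -> small (- x).
Hypothesis smallM : forall x y, small x -> small y -> small (x * y).
Hypothesis small_D : forall x, small x -> small (D x).
Hypothesis small_log : forall x, x != 0 -> small (D x / x).

Lemma small_dpot n : small (dpot n).
Proof.
apply: big_ind => // i _; rewrite mulr_natl mulr2n.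
by have /small_D s := small_log (dpsi_neq0 i); exact: smallD.
Qed.

(** The leading coefficient 1 enters lower ones only through D 1 = 0 or multiplied by the small
    y_n. *)
Lemma small_dpoly n k : (k < n)%N -> small (dpoly n)`_k.
Proof.
elim: n k => [//|n IHn] k ltk.
rewrite /= !(coefD, coefN, coef_mapD, coefXM, coefCM).
have sy : small (dlog n) by exact/small_log/dpsi_neq0.
have s1 : small (D (dpoly n)`_k).
  have [/IHn/small_D //|lenk] := ltnP k n.
  have -> : k = n by lia.
  by rewrite dpoly_lead D1.
have s2 : small (dlog n * (dpoly n)`_k).
  have [/IHn|lenk] := ltnP k n; first exact: smallM.
  have -> : k = n by lia.
  by rewrite dpoly_lead mulr1.
apply: smallD; last exact: smallN.
apply: smallD => //; case: k ltk {s1 s2} => [//|k] ltk /=.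
by apply: IHn; lia.
Qed.

(** If i + j = 2k < 2n, one of i, j is below n. *)
Lemma small_resolvent n k : (k < n)%N -> small (resolvent n)`_(2 * k).
Proof.
move=> ltk; rewrite coefM; apply: big_ind => // i _; rewrite coef_comp_polyNX.
have sS b x : small x -> small ((-1) ^+ b * x).
  by move=> sx; rewrite -signr_odd; case: odd; rewrite ?mul1r // mulN1r; exact: smallN.
have sW j m : (j < n)%N -> small ((dpoly n)`_j * (dpoly n)`_m).
  move=> ltj; have sj := small_dpoly ltj.
  have [ltm|ltm|->] := ltngtP m n; last by rewrite dpoly_lead mulr1.
    by apply: smallM => //; exact: small_dpoly.
  by rewrite [X in _ * X]dpoly_coef_high // mulr0.
rewrite mulrCA; apply: sS; have [lti|lei] := ltnP i n; first exact: sW.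
by rewrite mulrC; apply: sW; lia.
Qed.
End Small.
End Iteration.
End Darboux.

(** * Rational functions: derivation and behaviour at infinity *)

Section RationalFunctions.
Variable F : fieldType.
Local Notation K := {fraction {poly F}}.
Implicit Types (f g : K) (p q r s : {poly F}).

Lemma fracP f : exists p q, q != 0 /\ f = p%:F / q%:F.
Proof.
by exists (\n_(repr f)), (\d_(repr f)); split; [exact: denom_ratioP|exact: fraction_numden].
Qed.

Lemma frac_divf_eq p q r s : q != 0 -> s != 0 -> p * s = r * q ->
  p%:F / q%:F = r%:F / s%:F.
Proof.
move=> q0 s0 E; apply/eqP; rewrite eqr_div ?tofrac_eq0 //.
by rewrite -!tofracM E.
Qed.

Lemma frac_addf p q r s : q != 0 -> s != 0 ->
  p%:F / q%:F + r%:F / s%:F = (p * s + r * q)%:F / (q * s)%:F.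
Proof. by move=> q0 s0; rewrite addf_div ?tofrac_eq0 // -!tofracM -tofracD. Qed.

Lemma frac_mulf p q r s : (p%:F / q%:F) * (r%:F / s%:F) = (p * r)%:F / (q * s)%:F.
Proof. by rewrite mulf_div -!tofracM. Qed.

Lemma ratderiv_poly p : ratderiv p%:F = p^`()%:F.
Proof.
rewrite -[p%:F]divr1 -tofrac1 ratderivE ?oner_neq0 //.
by rewrite derivC mulr0 subr0 mulr1 expr1n tofrac1 divr1.
Qed.

Lemma ratderivD : {morph @ratderiv F : f g / f + g}.
Proof.
move=> f g; have [p [q [q0 ->]]] := fracP f; have [r [s [s0 ->]]] := fracP g.
rewrite frac_addf // !ratderivE ?mulf_neq0 // frac_addf ?expf_neq0 //.
apply: frac_divf_eq; rewrite ?expf_neq0 ?mulf_neq0 ?expf_neq0 //.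
rewrite !(derivD, derivM); ring.
Qed.

Lemma ratderivM f g : ratderiv (f * g) = ratderiv f * g + f * ratderiv g.
Proof.
have [p [q [q0 ->]]] := fracP f; have [r [s [s0 ->]]] := fracP g.
rewrite frac_mulf !ratderivE ?mulf_neq0 // !frac_mulf frac_addf ?mulf_neq0 ?expf_neq0 //.
apply: frac_divf_eq; rewrite ?expf_neq0 ?mulf_neq0 ?expf_neq0 //.
rewrite !derivM; ring.
Qed.

(* f vanishes at infinity. *)
Definition small f :=
  exists p q, [/\ q != 0, (size p < size q)%N & f = p%:F / q%:F].

Lemma size_mul_lt p q r s : q != 0 -> s != 0 -> (size p < size q)%N ->
  (size r <= size s)%N -> (size (p * r)%R < size (q * s)%R)%N.
Proof.
move=> q0 s0 ltpq lers; rewrite (size_mul q0 s0).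
have := size_polyMleq p r; have : (0 < size s)%N by rewrite size_poly_gt0.
by move: ltpq lers; move: (size p) (size q) (size r) (size s) (size _) => a b c d e; lia.
Qed.

Lemma small0 : small 0.
Proof. by exists 0, 1; rewrite oner_neq0 size_poly0 size_poly1 tofrac0 mul0r. Qed.

Lemma smallD f g : small f -> small g -> small (f + g).
Proof.
move=> [p [q [q0 ltpq ->]]] [r [s [s0 ltrs ->]]].
exists (p * s + r * q), (q * s); rewrite frac_addf // mulf_neq0 //; split=> //.
rewrite (leq_ltn_trans (size_polyD _ _)) // gtn_max size_mul_lt //.
by rewrite [q * s]mulrC size_mul_lt.
Qed.

Lemma smallM f g : small f -> small g -> small (f * g).
Proof.
move=> [p [q [q0 ltpq ->]]] [r [s [s0 ltrs ->]]].
exists (p * r), (q * s); rewrite frac_mulf mulf_neq0 //; split=> //.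
by apply: size_mul_lt => //; exact: ltnW.
Qed.

Lemma smallCM c f : small f -> small (c%:P%:F * f).
Proof.
move=> [p [q [q0 ltpq ->]]]; exists (c%:P * p), q; split=> //.
  by rewrite mul_polyC (leq_ltn_trans (size_scale_leq _ _)).
by rewrite mulrA -tofracM.
Qed.

Lemma smallN f : small f -> small (- f).
Proof. by move=> /(smallCM (-1)); rewrite polyCN tofracN tofrac1 mulN1r. Qed.

Lemma size_deriv_le p : (size p^`()%R <= size p)%N.
Proof.
have [->|p0] := eqVneq p 0; first by rewrite derivC.
exact/ltnW/lt_size_deriv.
Qed.

Lemma small_ratderiv f : small f -> small (ratderiv f).
Proof.
move=> [p [q [q0 ltpq ->]]]; rewrite ratderivE //.
exists (p^`() * q - p * q^`()), (q ^+ 2); split=> //; first by rewrite expf_neq0.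
rewrite (leq_ltn_trans (size_polyD _ _)) // size_polyN gtn_max expr2.
rewrite !size_mul_lt ?size_deriv_le //.
exact: leq_ltn_trans (size_deriv_le _) ltpq.
Qed.

Lemma small_dlog f : f != 0 -> small (ratderiv f / f).
Proof.
have [p [q [q0 ->]]] := fracP f => f0.
have p0 : p != 0 by apply: contraNneq f0 => ->; rewrite tofrac0 mul0r.
rewrite ratderivE // invf_div frac_mulf.
exists (p^`() * q - p * q^`()), (p * q); split; rewrite ?mulf_neq0 //.
  rewrite (leq_ltn_trans (size_polyD _ _)) // size_polyN gtn_max.
  rewrite size_mul_lt ?lt_size_deriv // [p * q]mulrC [p * _]mulrC.
  by rewrite size_mul_lt ?lt_size_deriv.
apply: frac_divf_eq; rewrite ?mulf_neq0 ?expf_neq0 //; ring.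
Qed.
End RationalFunctions.

Lemma coefM_top (R : nzRingType) (p q : {poly R}) m k :
  (size p <= m.+1)%N -> (size q <= k.+1)%N -> (p * q)`_(m + k) = p`_m * q`_k.
Proof.
move=> sp sq; have ltm : (m < (m + k).+1)%N by lia.
rewrite coefM (bigD1 (Ordinal ltm)) //= addKn big1 ?addr0 // => i ni.
have {ni} ni : i != m :> nat by rewrite -val_eqE in ni.
have [ltim|leim] := ltnP i m.
  by rewrite [q`__]nth_default ?mulr0 // (leq_trans sq) //; lia.
by rewrite nth_default ?mul0r // (leq_trans sp) //; lia.
Qed.

(** For p nonzero, comparing top coefficients in p' q = p q' gives deg p = deg q in characteristic
    0, against deg p < deg q. This fixes the constants of integration. *)
Lemma ratderiv_small_eq0 (F : numFieldType) (f : {fraction {poly F}}) :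
  small f -> ratderiv f = 0 -> f = 0.
Proof.
move=> [p [q [q0 ltpq ->]]]; rewrite ratderivE //.
move=> /eqP; rewrite mulf_eq0 invr_eq0 !tofrac_eq0 expf_eq0 /= (negPf q0) orbF subr_eq0.
move=> /eqP E; have [->|p0] := eqVneq p 0; first by rewrite tofrac0 mul0r.
(* Multiplying r' by X gives the coefficient (deg r) lead(r) at index deg r, even for constant r. *)
have sX (r : {poly F}) : r != 0 -> (size ('X * r^`())%R <= (size r).-1.+1)%N.
  move=> r0; rewrite prednK ?size_poly_gt0 //.
  have [->|dr0] := eqVneq r^`() 0; first by rewrite mulr0 size_poly0.
  by rewrite mulrC size_mulX // lt_size_deriv.
have cX (r : {poly F}) : r != 0 -> ('X * r^`())`_(size r).-1 = lead_coef r *+ (size r).-1.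
  move=> r0; rewrite coefXM coef_deriv /lead_coef.
  by case: (size r).-1 => [|j] //=; rewrite mulr0n.
have {}E : 'X * p^`() * q = p * ('X * q^`()) by rewrite -mulrA E mulrCA.
have := congr1 (fun r : {poly F} => r`_((size p).-1 + (size q).-1)) E.
rewrite !coefM_top ?sX ?cX ?leqSpred // -!/(lead_coef _).
rewrite mulrnAl mulrnAr -mulr_natr -[RHS]mulr_natr => /mulfI.
rewrite mulf_neq0 ?lead_coef_eq0 // => /(_ isT)/eqP; rewrite eqr_nat => /eqP.
move: ltpq p0; rewrite -size_poly_gt0.
by move: (size p) (size q) => a b; lia.
Qed.

(** * Differential polynomials: induction and substitution *)

Lemma cmonom_ind (I : choiceType) (P : {cmonom I} -> Prop) :
  P mone -> (forall i m, P m -> P (mmul (ucm i) m)) -> forall m, P m.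
Proof.
move=> P1 PU m; have [d] := ubnP (mdeg m); elim: d m => // d IHd m ltd.
have [->//|m1] := eqVneq m mone.
have [im0|[i im]] := fset_0Vmem (finsupp m).
  case/eqP: m1; apply/eqP/cmP => i; rewrite cm1.
  by apply/eqP; rewrite cmE_eq0 im0 inE.
have mE : m = mmul (ucm i) (divcm m (ucm i)).
  apply/eqP/cmP => j; rewrite cmM divcmE cmU subnKC //.
  by case: eqVneq => // <-; rewrite lt0n cmE_neq0.
rewrite mE; apply: PU; apply: IHd.
by move: ltd; rewrite {1}mE mdegM mdegU.
Qed.

Lemma diffpoly_ind (F : fieldType) (P : diffpoly F -> Prop) :
  (forall c, P c%:MP) -> (forall i, P (uvar F i)) ->
  (forall p q, P p -> P q -> P (p + q)) ->
  (forall p q, P p -> P q -> P (p * q)) -> forall p, P p.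
Proof.
move=> PC PX PD PM; elim/malg_ind => [c m|p q]; last exact: PD.
have -> : << c *g m >> = c%:MP * << m >> :> diffpoly F.
  by rewrite mul_malgC malgU1Z.
apply: (PM) => //; elim/cmonom_ind: m => [|i m IHm]; first exact: PC.
rewrite (malgU1M F (ucm i) m); apply: PM; [exact: PX|exact: IHm].
Qed.

Section Substitution.
Variables (F : fieldType) (w : {fraction {poly F}}).
Implicit Types (P Q : diffpoly F) (m : {cmonom nat}).
Local Notation D := (@ratderiv F).

Let mu m : {fraction {poly F}} := \prod_(i <- finsupp m) iter i D w ^+ m i.

Let muEw m (d : {fset nat}) : (finsupp m `<=` d)%fset ->
  mu m = \prod_(i <- d) iter i D w ^+ m i.
Proof.
move=> le; apply: big_fset_incl => // i _.
by rewrite -cmE_eq0 => /eqP ->; rewrite expr0.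
Qed.

Let muM m1 m2 : mu (mmul m1 m2) = mu m1 * mu m2.
Proof.
have le1 : (finsupp m1 `<=` finsupp (mmul m1 m2))%fset.
  by rewrite mdomD; exact: fsubsetUl.
have le2 : (finsupp m2 `<=` finsupp (mmul m1 m2))%fset.
  by rewrite mdomD; exact: fsubsetUr.
rewrite (muEw le1) (muEw le2) (muEw (fsubset_refl _)) -big_split /=.
by apply: eq_bigr => i _; rewrite cmM exprD.
Qed.

Lemma dpsubstU c m : dpsubst << c *g m >> w = c%:P%:F * mu m.
Proof. exact: mmapU. Qed.

Lemma dpsubstD P Q : dpsubst (P + Q) w = dpsubst P w + dpsubst Q w.
Proof. exact: mmapD. Qed.

Lemma dpsubstC c : dpsubst c%:MP w = c%:P%:F.
Proof. by rewrite dpsubstU /mu mdom1 big_seq_fset0 mulr1. Qed.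

Lemma dpsubstX i : dpsubst (uvar F i) w = iter i D w.
Proof. by rewrite dpsubstU /mu mdomU big_seq_fset1 cmUU expr1 mul1r. Qed.

Lemma dpsubstM P Q : dpsubst (P * Q) w = dpsubst P w * dpsubst Q w.
Proof.
have mu_mmorphism : mmorphism mu.
  split; first exact: muM.
  by rewrite /mu mdom1 big_seq_fset0.
pose mumm : {mmorphism {cmonom nat} -> {fraction {poly F}}} :=
  HB.pack mu (monalg.isMultiplicative.Build _ _ mu mu_mmorphism).
exact: (@mmap_is_multiplicative _ _ _ (@FracField.tofrac {poly F} \o polyC) mumm).1.
Qed.

Lemma dpsubst_nat n : dpsubst n%:R w = n%:R.
Proof. by rewrite -mpolyC_nat dpsubstC polyC_natr tofracMn tofrac1. Qed.

(** Both sides obey the Leibniz rule, so constants and generators suffice. *)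
Lemma dpsubst_deriv P : dpsubst (dpderiv P) w = D (dpsubst P w).
Proof.
elim/diffpoly_ind: P => [c|i|P Q IHP IHQ|P Q IHP IHQ].
- by rewrite dpderivC dpsubstC ratderiv_poly derivC tofrac0; exact: mmap0.
- rewrite (dpderivX F i).
  exact: etrans (dpsubstX i.+1) (congr1 D (esym (dpsubstX i))).
- apply: etrans (congr1 (@dpsubst F ^~ w) (dpderivD P Q)) _.
  apply: etrans (dpsubstD _ _) _; apply: etrans (congr2 +%R IHP IHQ) _.
  exact: esym (etrans (congr1 D (dpsubstD P Q)) (ratderivD _ _)).
apply: etrans (congr1 (@dpsubst F ^~ w) (dpderivM P Q)) _.
apply: etrans (dpsubstD _ _) _.
apply: etrans (congr2 +%R (dpsubstM _ _) (dpsubstM _ _)) _.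
apply: etrans (congr2 (fun p q => p * dpsubst Q w + dpsubst P w * q) IHP IHQ) _.
exact: esym (etrans (congr1 D (dpsubstM P Q)) (ratderivM _ _)).
Qed.

(** P[w] differs from the constant term of P by a small function, and P[0] = 0 makes this term
    zero. *)
Lemma small_dpsubst P : small w -> dpsubst P 0 = 0 -> small (dpsubst P w).
Proof.
move=> sw; have siter i : small (iter i D w) by elim: i => //= i; exact: small_ratderiv.
have s : small (dpsubst P w - (mcoeff mone P)%:P%:F).
  elim/diffpoly_ind: P => [c|i|P Q IHP IHQ|P Q IHP IHQ].
  - by rewrite dpsubstC malgCK subrr; exact: small0.
  - by rewrite (dpsubstX i) mcoeff1_uvar tofrac0 subr0.
  - have -> : dpsubst (P + Q) w - (mcoeff mone (P + Q))%:P%:F =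
      (dpsubst P w - (mcoeff mone P)%:P%:F) + (dpsubst Q w - (mcoeff mone Q)%:P%:F).
      apply: etrans (congr2 (fun x y : {fraction {poly F}} => x - y) (dpsubstD P Q)
        (congr1 (fun c => c%:P%:F) (mcoeffD mone P Q))) _.
      by move: (dpsubst P w) (dpsubst Q w) => p q; rewrite polyCD tofracD; ring.
    exact: smallD.
  have -> : dpsubst (P * Q) w - (mcoeff mone (P * Q))%:P%:F =
      (dpsubst P w - (mcoeff mone P)%:P%:F) * (dpsubst Q w - (mcoeff mone Q)%:P%:F)
      + ((mcoeff mone P)%:P%:F * (dpsubst Q w - (mcoeff mone Q)%:P%:F)
         + (mcoeff mone Q)%:P%:F * (dpsubst P w - (mcoeff mone P)%:P%:F)).
    apply: etrans (congr2 (fun x y : {fraction {poly F}} => x - y) (dpsubstM P Q)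
      (congr1 (fun c => c%:P%:F) (mcoeff1M P Q))) _.
    by move: (dpsubst P w) (dpsubst Q w) => p q; rewrite polyCM tofracM; ring.
  by apply: smallD; [exact: smallM|apply: smallD; exact: smallCM].
by rewrite dpsubst0 => P0; rewrite P0 subr0 in s.
Qed.

End Substitution.

Lemma dpsubst_lenardS (F : numFieldType) (w : {fraction {poly F}}) k
    (l := fun k => dpsubst (lenard F k) w) :
  ratderiv (l k.+1) = ratderiv (ratderiv (ratderiv (l k)))
    + 4 * w * ratderiv (l k) + 2 * ratderiv w * l k.
Proof.
have [_ /(_ k) E _] := lenardP F; rewrite /l.
apply: etrans (esym (dpsubst_deriv w _)) _.
apply: etrans (congr1 (@dpsubst F ^~ w) E) _.
apply: etrans (dpsubstD _ _ _) _; congr (_ + _).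
  apply: etrans (dpsubstD _ _ _) _; congr (_ + _).
    apply: etrans (dpsubst_deriv _ _) _; congr ratderiv.
    by apply: etrans (dpsubst_deriv _ _) _; congr ratderiv; exact: dpsubst_deriv.
  apply: etrans (dpsubstM _ _ _) _; congr (_ * _); last exact: dpsubst_deriv.
  apply: etrans (dpsubstM _ _ _) _; congr (_ * _); first exact: dpsubst_nat.
  exact: (dpsubstX w 0).
apply: etrans (dpsubstM _ _ _) _; congr (_ * _).
apply: etrans (dpsubstM _ _ _) _; congr (_ * _); first exact: dpsubst_nat.
exact: (dpsubstX w 1).
Qed.

(** * The h_k of Schur polynomials and their recursion *)

Lemma hschur0 (F : numFieldType) (T : nat -> F) : hschur T 0 = 1.
Proof.
rewrite /= /exp_trunc big_ord1 big_geq // expr0 fact0 invr1 scale1r.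
by rewrite coef1.
Qed.

(** Coefficient of z^k in d/dz exp(p) = p' exp(p). *)
Lemma hschurS (F : numFieldType) (T : nat -> F) k :
  hschur T k.+1 *+ k.+1 = \sum_(j < k.+1) (T j.+1 *+ j.+1) * hschur T (k - j)%N.
Proof.
pose p : {poly F} := \sum_(1 <= j < k.+2) T j *: 'X^j.
have cp j : (j <= k)%N -> p`_j.+1 = T j.+1.
  move=> lej; rewrite /p coef_sum (bigD1_seq j.+1) ?mem_index_iota ?iota_uniq //=.
  rewrite coefZ coefXn eqxx mulr1 big1 ?addr0 // => i /negPf ni.
  by rewrite coefZ coefXn eq_sym ni mulr0.
have p0 : exists r, p = r * 'X.
  exists (\sum_(1 <= j < k.+2) T j *: 'X^(j.-1)); rewrite mulr_suml.
  rewrite /p !big_nat; apply: eq_bigr => -[|j] //= _.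
  by rewrite -scalerAl -exprSr.
(* Differentiation drops the last term p^(k+1)/(k+1)!, which is divisible by z^(k+1) and does not
   reach z^k. *)
have E : (exp_trunc k.+1 T)^`() =
    p^`() * (exp_trunc k.+1 T - (k.+1`!%:R)^-1 *: p ^+ k.+1).
  rewrite /exp_trunc -/p; rewrite [in RHS]big_ord_recr /= addrK big_ord_recl /=.
  rewrite expr0 derivD derivZ derivC scaler0 add0r raddf_sum mulr_sumr /=.
  apply: eq_bigr => i _; rewrite derivZ deriv_exp /= -scaler_nat scalerA -scalerAr.
  congr (_ *: _); rewrite /bump add1n factS natrM invfM mulrAC mulVf ?mul1r //.
  by rewrite pnatr_eq0.
have := congr1 (fun q : {poly F} => q`_k) E; rewrite coef_deriv => Ek.
have [r pE] := p0; rewrite {1}/hschur {}Ek coefM; apply: eq_bigr => j _.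
have lejk : (j <= k)%N by rewrite -ltnS.
rewrite coef_deriv cp // coefB coefZ pE exprMn coefMXn ltnS leq_subr mulr0 subr0.
by rewrite /hschur -(@exp_trunc_stable _ _ _ k.+1) // (leq_trans (leq_subr _ _)).
Qed.

(** * The h_k as polynomials in x *)

Section HPoly.
Variables (F : numFieldType) (a : nat -> {poly F}).

(** The recursion calls all earlier values, so n is a fuel; every n >= k gives the same result. *)
Fixpoint hpoly_rec n k : {poly F} :=
  if n is n'.+1 then
    if k is k'.+1 then
      k'.+1%:R^-1 *: \sum_(j < k'.+1) a j * hpoly_rec n' (k' - j)%N
    else 1
  else 1.

Definition hpoly k := hpoly_rec k k.

Lemma hpoly_rec_stable n k : (k <= n)%N -> hpoly_rec n k = hpoly k.
Proof.
rewrite /hpoly; elim/ltn_ind: n k => -[|n] IHn [|k] // lekn.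
rewrite /=; congr (_ *: _); apply: eq_bigr => j _.
have lek := leq_subr j k; rewrite ltnS in lekn.
by rewrite (IHn n (ltnSn n) _ (leq_trans lek lekn)) (IHn k _ _ lek).
Qed.

Lemma hpolyS k : hpoly k.+1 *+ k.+1 = \sum_(j < k.+1) a j * hpoly (k - j)%N.
Proof.
rewrite {1}/hpoly /= -scaler_nat scalerA divff ?pnatr_eq0 // scale1r.
by apply: eq_bigr => j _; rewrite hpoly_rec_stable ?leq_subr.
Qed.

(** Only a_0 = x depends on x, so the recursion gives (k+1) h_(k+1)' = h_k + k h_k. *)
Lemma hpoly_deriv k : a 0%N = 'X -> (forall j, (a j.+1)^`() = 0) ->
  (hpoly k.+1)^`() = hpoly k.
Proof.
move=> a0 aS; elim/ltn_ind: k => k IHk.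
have k0 : k.+1%:R != 0 :> F by rewrite pnatr_eq0.
apply: (scalerI k0); rewrite !scaler_nat -derivMn hpolyS raddf_sum /=.
under eq_bigr => j _ do rewrite derivM.
rewrite big_split /= big_ord_recl a0 derivX mul1r subn0.
rewrite big1 => [|j _]; last by rewrite aS mul0r.
rewrite addr0 mulrS; congr (_ + _).
rewrite big_ord_recr /= subnn derivC mulr0 addr0; case: k k0 IHk => [|k] _ IHk.
  by rewrite big_ord0.
rewrite hpolyS; apply: eq_bigr => j _; have ltj := ltn_ord j.
by rewrite subSn -1?ltnS // IHk // ltnS leq_subr.
Qed.
End HPoly.

Lemma sum_even (V : nmodType) (f : nat -> V) n : (forall k, odd k -> f k = 0) ->
  \sum_(i < (2 * n).+1) f i = \sum_(k < n.+1) f (2 * k)%N.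
Proof.
move=> f_odd; elim: n => [|n IHn]; first by rewrite !big_ord1.
rewrite (_ : (2 * n.+1).+1 = (2 * n).+3)%N; last by lia.
rewrite 2!big_ord_recr /= IHn [RHS]big_ord_recr /= -addrA; congr (_ + _).
rewrite f_odd; last by lia.
by rewrite add0r; congr f; lia.
Qed.

(** Here P = psi_0 ... psi_(n-1), p = psi_n, q = psi_(n+1), m = 2n+3, and c, c e, c e (m e) are the
    constants of three consecutive tau functions. *)
Lemma vy_step_identity (L : fieldType) (p q P c e m : L) :
  p != 0 -> P != 0 -> c != 0 ->
  (c * e * (P * p)) ^+ 2 * (m * q / p) / (c * P)
  = c * e * (m * e) * (P * p * q).
Proof. by move=> p0 P0 c0; field; rewrite p0 P0 c0. Qed.

(** Rows and columns undergo the same permutation, so its sign is squared. *)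
Lemma det_rev_ord (A : comNzRingType) n (B : 'M[A]_n) :
  \det (\matrix_(i, j) B (rev_ord i) (rev_ord j)) = \det B.
Proof.
pose s := perm (@rev_ord_inj n).
have -> : \matrix_(i, j) B (rev_ord i) (rev_ord j) = row_perm s (col_perm s B).
  by apply/matrixP => i j; rewrite !mxE !permE.
rewrite row_permE col_permE !det_mulmx !det_perm odd_permV mulrCA -signr_addb addbb.
by rewrite mulr1.
Qed.

(** * The Darboux construction at the given times and the recurrence for tau_n *)

Section Assembly.
Variables (F : numFieldType) (N : nat) (t : (N.-1).-tuple F).
Local Notation K := {fraction {poly F}}.
Local Notation D := (@ratderiv F).

(** The coefficients of A; x occurs in a_0 only, and the argument 0 of [schur_arg] is a placeholder
    for it. *)
Definition atime j : {poly F} :=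
  if j is 0 then 'X else (schur_arg t 0 j.+1 *+ j.+1)%:P.

Local Notation H := (hpoly atime).
Local Notation h := (fun k => (H k)%:F).
Local Notation psi := (dpsi D h).
Local Notation u := (dpot D h).

Lemma horner_hpoly x k : (H k).[x] = hschur (schur_arg t x) k.
Proof.
elim/ltn_ind: k => -[|k] IHk; first by rewrite hschur0 hornerC.
have k0 : k.+1%:R != 0 :> F by rewrite pnatr_eq0.
apply: (mulIf k0); rewrite !mulr_natr -hornerMn hpolyS hschurS horner_sum.
apply: eq_bigr => j _; rewrite hornerM IHk ?ltnS ?leq_subr //; congr (_ * _).
by case: (val j) => [|i]; rewrite /= ?hornerX ?hornerC.
Qed.

Let DM := @ratderivM F.
Let DD := @ratderivD F.

Let h0 : h 0%N = 1.
Proof. exact: tofrac1. Qed.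

Let Dh k : D (h k.+1) = h k.
Proof. by rewrite ratderiv_poly hpoly_deriv // => j; rewrite derivC. Qed.

Let a k : K := (atime k)%:F.

Let char0 k : k.+1%:R != 0 :> K.
Proof. by rewrite -tofrac1 -tofracMn tofrac_eq0 -polyC1 -polyCMn polyC_eq0 pnatr_eq0. Qed.

Let a_odd k : odd k -> a k = 0.
Proof.
rewrite /a; case: k => [//|k] /= ok.
by rewrite /schur_arg /= ok mul0rn tofrac0.
Qed.

Let hE k : h k.+1 *+ k.+1 = \sum_(j < k.+1) a j * h (k - j)%N.
Proof.
rewrite -tofracMn hpolyS rmorph_sum; apply: eq_bigr => j _.
exact: tofracM.
Qed.

Let small_u n : small (u n).
Proof.
exact: (small_dpot DD DM h0 Dh (@small0 F) (@smallD F) (@small_ratderiv F) (@small_dlog F)).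
Qed.

Local Notation R n := (resolvent D h n).

(* Both sides vanish at infinity for k > 0, so comparing derivatives suffices. *)
Lemma lenard_resolvent n k : 2 * dpsubst (lenard F k) (u n) =
  if (k <= n)%N then (4 ^+ k * (-1) ^+ n)%:P%:F * (R n)`_(2 * (n - k)) else 0.
Proof.
pose op y := D (D (D y)) + 4 * u n * D y + 2 * D (u n) * y.
have DC c : D c%:P%:F = 0 by rewrite ratderiv_poly derivC tofrac0.
have D2 : D 2 = 0 := lenard_Dnat DD DM 2.
have D4 : D 4 = 0 := lenard_Dnat DD DM 4.
have DCM c y : D c = 0 -> D (c * y) = c * D y by move=> Dc; rewrite DM Dc mul0r add0r.
have opC c y : D c = 0 -> op (c * y) = c * op y.
  by move=> Dc; rewrite /op !(DCM c) //; ring.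
elim: k => [|k IHk].
  have [L0 _ _] := lenardP F.
  rewrite L0 dpsubstC leq0n subn0 expr0 mul1r resolvent_lead //.
  have -> : ((-1) ^+ n)%:P%:F = (-1) ^+ n :> K.
    by rewrite polyC_exp polyCN tofracXn tofracN tofrac1.
  rewrite -expr2 sqrr_sign mulr_natl -tofracMn -polyCMn -[_ *+ 2]mulr_natl.
  by rewrite divff ?pnatr_eq0.
apply/eqP; rewrite -subr_eq0; apply/eqP; apply: ratderiv_small_eq0.
  apply: smallD.
    rewrite mulr_natl mulr2n; have [_ _ L0] := lenardP F.
    by apply: smallD; exact/small_dpsubst/L0.
  case: ifP => ltkn; last by rewrite oppr0; exact: small0.
  apply/smallN/smallCM.
  apply: (small_resolvent DD DM h0 Dh (@small0 F) (@smallD F) (@smallN F) (@smallM F)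
    (@small_ratderiv F) (@small_dlog F)).
  by rewrite ltn_subrL /=; exact: leq_trans ltkn.
have E : D (2 * dpsubst (lenard F k.+1) (u n)) = op (2 * dpsubst (lenard F k) (u n)).
  by rewrite (opC 2) // (DCM 2) // dpsubst_lenardS.
rewrite DD (lenard_DN DD) {}E {}IHk.
(* For k < n, [resolvent_ode] yields the next coefficient of R and the extra factor 4; for k = n,
   [resolvent_ode0] yields 0; afterwards everything is 0. *)
have [ltkn|lenk] := ltnP k n.
  rewrite (ltnW ltkn) opC // DCM // /op.
  have -> : (n - k = (n - k.+1).+1)%N by lia.
  rewrite resolvent_ode //.
  have -> : (4 ^+ k.+1 * (-1) ^+ n)%:P%:F = 4 * (4 ^+ k * (-1) ^+ n)%:P%:F :> K.
    by rewrite exprS -mulrA polyCM tofracM polyC_natr tofracMn tofrac1.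
  ring.
rewrite (lenard_D0 DD) subr0; move: lenk; rewrite leq_eqVlt => /predU1P[<-|ltnk].
  rewrite leqnn opC // subnn muln0 /op resolvent_ode0 //; ring.
by rewrite leqNgt ltnk /= /op !(lenard_D0 DD) !mulr0 !addr0.
Qed.
(** By [lenard_resolvent] the left side is (-1)^n times the sum of a_(2k) R_(2n-2k), the coefficient
    of z^(2n) in A R, which [darboux_key] evaluates. *)
Lemma vy_bracket n : (0 < N)%N ->
  'X%:F - 2 * dpsubst (lenard F N) (u n)
    + 2 * \sum_(1 <= k < N)
            ((2 * k + 1)%:R * oddtime t k)%:P%:F * dpsubst (lenard F k) (u n)
  = (-1) ^+ n * ((2 * n + 1)%:R * psi n * darboux D h n 0).
Proof.
move=> N0.
pose b k : F := (2 * k + 1)%:R * oddtime t k.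
transitivity ('X%:F + \sum_(1 <= k < N.+1) (b k)%:P%:F * (2 * dpsubst (lenard F k) (u n))).
  (* The choice t_(2N+1) = -1/(2N+1) makes -2 L_N the term k = N of the sum. *)
  have bN : b N = -1 by rewrite /b /oddtime eqxx mulrN divff // pnatr_eq0 addn1.
  rewrite big_nat_recr //= bN polyCN polyC1 tofracN tofrac1 mulN1r -addrA; congr (_ + _).
  rewrite addrC mulr_sumr; congr (_ + _); apply: eq_bigr => k _.
  by rewrite mulrCA.
have ltM : (2 * n + 1 < 2 * n + 2)%N by lia.
have := darboux_key DD DM h0 Dh char0 a_odd hE ltM.
rewrite -/(R n) => <-; rewrite coefM.
pose f k := (\poly_(i < 2 * n + 2) a i)`_k * (R n)`_(2 * n - k).
have fE k : (k <= 2 * n)%N -> f k = a k * (R n)`_(2 * n - k).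
  by move=> lek; rewrite /f coef_poly ifT //; lia.
rewrite -/(\sum_(k < (2 * n).+1) f k) sum_even; last first.
  by move=> k ok; rewrite /f coef_poly a_odd // if_same mul0r.
(* The factor 2^(2k) in the Schur arguments is the 4^k of [lenard_resolvent]. *)
have aE k : (0 < k)%N -> a (2 * k)%N = if (k <= N)%N then (b k * 4 ^+ k)%:P%:F else 0.
  move=> k0; rewrite /a /atime; case: k k0 => // k _.
  have -> : (2 * k.+1 = (2 * k).+2)%N by lia.
  have half3 : (2 * k).+3./2 = k.+1 by lia.
  have odd3 : odd (2 * k).+3 by lia.
  rewrite /schur_arg half3 odd3 ltn0Sn !andTb (_ : (2 * k).+3 == 1%N = false) //.
  case: ifP => _; last by rewrite mul0rn tofrac0.
  congr (_%:P%:F); rewrite /b exprM (_ : 2 ^+ 2 = 4 :> F); last by rewrite -natrX.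
  rewrite -[LHS]mulr_natr (_ : (2 * k).+3 = 2 * k.+1 + 1)%N; last by lia.
  move: (oddtime t k.+1) (2 * k.+1 + 1)%:R => *; ring.
rewrite mulr_sumr big_ord_recl /= muln0 fE // subn0 resolvent_lead //.
rewrite mulrCA -expr2 sqrr_sign mulr1; congr (_ + _).
pose g k := (b k)%:P%:F * (2 * dpsubst (lenard F k) (u n)).
pose g' k := (-1) ^+ n * f (2 * k)%N.
have -> : \sum_(i < n) (-1) ^+ n * f (2 * bump 0 i)%N = \sum_(1 <= k < n.+1) g' k.
  by rewrite big_add1 big_mkord.
(* The sums stop at N and at n; on a common range the extra terms vanish, as a_(2k) = 0 for k > N
   and L_k[u_n] = 0 for k > n. *)
rewrite (big_nat_widen 1 N.+1 (maxn N n).+1) ?ltnS ?leq_maxl //.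
rewrite [RHS](big_nat_widen 1 n.+1 (maxn N n).+1) ?ltnS ?leq_maxr //.
rewrite big_mkcond [RHS]big_mkcond /= !big_nat; apply: eq_bigr => k /andP[k0 _].
rewrite !ltnS lenard_resolvent /g'; have [lekn|ltnk] := leqP k n; last first.
  by rewrite mulr0 if_same.
rewrite fE ?aE; try lia.
case: ifP => _; last by rewrite mul0r mulr0.
rewrite (_ : 2 * (n - k) = 2 * n - 2 * k)%N; last by lia.
rewrite !polyCM !tofracM.
have -> : ((-1) ^+ n)%:P%:F = (-1) ^+ n :> K.
  by rewrite polyC_exp polyCN tofracXn tofracN tofrac1.
ring.
Qed.

Let psi_neq0 n : psi n != 0.
Proof. exact: (dpsi_neq0 DD DM h0 Dh n). Qed.

(** This is the double factorial (2k-1)!!. *)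
Definition oddfact k : F := (2 * k)`!%:R / (2 ^+ k * k`!%:R).

Lemma oddfactS k : oddfact k.+1 = (2 * k + 1)%:R * oddfact k.
Proof.
rewrite /oddfact mulnS !factS !natrM exprS -addn1 -!natr1 natrD !natrM.
have f0 : k`!%:R != 0 :> F by rewrite pnatr_eq0 -lt0n fact_gt0.
have p0 : 2 ^+ k != 0 :> F by rewrite expf_neq0 ?pnatr_eq0.
have k0 : k%:R + 1 != 0 :> F by rewrite natr1 pnatr_eq0.
by field; rewrite f0 k0 add0r andbT; exact: p0.
Qed.

Lemma oddfact_neq0 k : oddfact k != 0.
Proof. by rewrite !(mulf_neq0, invr_neq0, expf_neq0) ?pnatr_eq0 -?lt0n ?fact_gt0. Qed.

Definition vycst n : F := \prod_(1 <= k < n.+1) oddfact k.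

Lemma vycstS n : vycst n.+1 = vycst n * oddfact n.+1.
Proof. by rewrite /vycst big_nat_recr. Qed.

Lemma vycst_neq0 n : vycst n != 0.
Proof.
elim: n => [|n IHn]; first by rewrite /vycst big_geq ?oner_neq0.
by rewrite vycstS mulf_neq0 ?oddfact_neq0.
Qed.

Definition vytau n : K := (vycst n)%:P%:F * \prod_(i < n) psi i.

Lemma d2ln_vytau n : 2 * d2ln (vytau n) = u n.
Proof.
have logM f g : f != 0 -> g != 0 -> D (f * g) / (f * g) = D f / f + D g / g :> K.
  move=> f0 g0; rewrite (addf_div (D f) (D g) f0 g0); congr (_ / _).
  exact: etrans (DM f g) (congr1 (+%R _) (mulrC f (D g))).
have -> : d2ln (vytau n) = D (\sum_(i < n) dlog D h i).
  rewrite /d2ln /vytau; congr ratderiv.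
  rewrite logM ?tofrac_eq0 ?polyC_eq0 ?vycst_neq0 //; last first.
    by apply/prodf_neq0 => i _; exact: psi_neq0.
  rewrite ratderiv_poly derivC tofrac0 mul0r add0r.
  elim: n => [|n IHn]; first by rewrite !big_ord0 -tofrac1 ratderiv_poly derivC tofrac0 mul0r.
  rewrite !big_ord_recr /= logM ?IHn //.
  by apply/prodf_neq0 => i _; exact: psi_neq0.
by rewrite (big_morph D DD (lenard_D0 DD)) mulr_sumr.
Qed.

(** By [darboux_at0] the bracket for u_(n+1) is (2n+3) psi_(n+1) / psi_n, the two signs cancelling;
    2n+3 turns (2n+1)!! into (2n+3)!!. *)
Lemma vy_next_vytau n : (0 < N)%N ->
  vy_next t (vytau n) (vytau n.+1) = vytau n.+2.
Proof.
move=> N0; rewrite /vy_next d2ln_vytau vy_bracket // (darboux_at0 DD DM h0 Dh).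
have := psi_neq0 n; have := psi_neq0 n.+1.
have P0 : \prod_(i < n) psi i != 0 by apply/prodf_neq0 => i _; exact: psi_neq0.
pose c : K := (vycst n)%:P%:F; pose e : K := (oddfact n.+1)%:P%:F.
pose m : K := (2 * n.+1 + 1)%:R.
have c0 : c != 0 by rewrite tofrac_eq0 polyC_eq0 vycst_neq0.
have c1E : (vycst n.+1)%:P%:F = c * e by rewrite vycstS polyCM tofracM.
have c2E : (vycst n.+2)%:P%:F = c * e * (m * e).
  rewrite vycstS oddfactS (polyCM (vycst n.+1)) tofracM c1E.
  by rewrite (polyCM _ (oddfact n.+1)) tofracM polyC_natr tofracMn tofrac1.
rewrite /vytau c1E c2E !big_ord_recr /= -/c -/m => _ p0.
have ss : (-1) ^+ n.+1 * (-1) ^+ n.+1 = 1 :> K by rewrite -expr2 sqrr_sign.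
have sE s x q p : s * s = 1 -> s * (x * q * (s / p)) = x * q / p :> K.
  by move=> s1; rewrite -[RHS]mul1r -s1; ring.
rewrite (sE _ _ _ _ ss).
by have := @vy_step_identity K (psi n) (psi n.+1) _ c e m p0 P0 c0; apply.
Qed.

Lemma vy_pair_vytau n : (0 < N)%N -> vy_pair t n = (vytau n, vytau n.+1).
Proof.
move=> N0; elim: n => [|n IHn] /=; last by rewrite IHn vy_next_vytau.
have psi0 : psi 0 = 'X%:F.
  rewrite /dpsi /darboux /= /hpoly /= big_ord1 /atime invr1 scale1r mulr1 //.
have v1 : vycst 1 = 1.
  rewrite /vycst big_nat1 oddfactS /oddfact muln0 fact0 expr0 !mulr1.
  by rewrite divr1 mulr1.
rewrite /vytau big_ord0 big_ord1 psi0 v1 /vycst big_geq //.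
by rewrite polyC1 tofrac1 !mul1r.
Qed.

(** The polynomial behind tau_n. The guard encodes h_k = 0 for k < 0, where truncated subtraction
    would give h_0 = 1. *)
Definition vypoly n : {poly F} :=
  (vycst n)%:P *
  \det (\matrix_(j < n, k < n) (if (k <= 2 * j + 1)%N then H (2 * j + 1 - k)%N else 0)).

Lemma genVY_vypoly n : (0 < N)%N -> genVY t n = (vypoly n)%:F.
Proof.
move=> N0; rewrite /genVY vy_pair_vytau // /vytau /vypoly tofracM.
congr (_ * _); rewrite -(det_darboux DD DM h0 Dh) -det_map_mx; congr (\det _).
by apply/matrixP => j k; rewrite !mxE; case: ifP => _ //; rewrite tofrac0.
Qed.

Lemma horner_vypoly n x :
  (vypoly n).[x] = vycst n * schur (staircase n) (schur_arg t x).
Proof.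
have schurE la m (T : nat -> F) : size la = m -> schur la T =
    \det (\matrix_(j < m, k < m) hschur T ((nth 0%N la j)%:Z - j%:Z + k%:Z)).
  by move=> <-.
rewrite hornerM hornerC (schurE _ n); last by rewrite size_rev size_iota.
(* Reversing rows and columns turns 2j+1-k into (n-j) - j + k, where n-j is the part at position j
   counted from 0. *)
congr (_ * _); rewrite -/(horner_eval x _) -det_map_mx -[LHS]det_rev_ord; congr (\det _).
apply/matrixP => j k; rewrite !mxE nth_rev ?size_iota //.
have ltj := ltn_ord j; have ltk := ltn_ord k.
rewrite nth_iota; last by lia.
set z : int := _ - _ + _; rewrite [(rev_ord j : nat)]/= [(rev_ord k : nat)]/=.
case: ifP => le.
  have -> : z = (2 * (n - j.+1) + 1 - (n - k.+1))%N by rewrite /z; lia.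
  exact: (horner_hpoly x).
rewrite rmorph0; have : (z < 0)%R by rewrite /z; lia.
by case: z.
Qed.
End Assembly.

Theorem theorem1p2 (R : realType) (N n : nat) (hN : (1 <= N)%N)
    (hn : (1 <= n)%N) (t : (N.-1).-tuple R[i]) :
  exists Q : {poly R[i]}, genVY t n = Q%:F /\
    forall x : R[i],
      Q.[x] = (\prod_(1 <= k < n.+1) ((2 * k)`!%:R / (2 ^+ k * k`!%:R)))
              * schur (staircase n) (schur_arg t x).
Proof.
exists (vypoly t n); split; first exact: genVY_vypoly.
by move=> x; rewrite horner_vypoly.
Qed.
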